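(* Let $T\in(0,\infty)$ and let $\big(\Omega,\mathscr{F},(\mathscr{F}_t)_{t\in[0,T]},\mathbf{P}\big)$ be a complete filtered probability space with $\mathscr{F}_T=\mathscr{F}$, whose filtration satisfies the usual conditions (right-continuity and completeness). Let $d\in\mathbb{N}$ and let $S=(S^1_t,\ldots,S^d_t)_{t\in[0,T]}$ be an adapted $d$-dimensional process with continuous paths and values in $(0,\infty)^d$. If $S$ is sticky, then for every $\varepsilon>0$ the process $S$ admits an $\varepsilon$-consistent price system.
   Context: For $x\in\mathbb{R}^d$ let $\|x\|=\max(|x_1|,\ldots,|x_d|)$. For a stopping time $\tau\in[0,T]$ write $S^\star_\tau=\sup_{u\in[\tau,T]}\|S_u-S_\tau\|$. The process $S$ is called sticky if for every deterministic $t\in[0,T)$ and every $\delta>0$, $\mathbf{P}[S^\star_t<\delta\mid\mathscr{F}_t]>0$ almost surely. An adapted $d$-dimensional process $(M_t)_{t\in[0,T]}$ is an $\varepsilon$-consistent price system for $S$ if for every $i\in\{1,\ldots,d\}$ and $t\in[0,T]$ one has $\frac{S^i_t}{1+\varepsilon}\le M^i_t\le(1+\varepsilon)S^i_t$ almost surely, and there exists a probability measure $\mathbf{Q}$ on $(\Omega,\mathscr{F})$ with $\mathbf{Q}\sim\mathbf{P}$ such that $M$ is a $\mathbf{Q}$-martingale. *)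

(* Defs.v *)
From HB Require Import structures.
From mathcomp Require Import all_boot all_order all_algebra.
From mathcomp Require Import all_classical all_reals all_analysis.
Set Implicit Arguments. Unset Strict Implicit. Unset Printing Implicit Defensive.
Import Order.TTheory GRing.Theory Num.Theory.
Import numFieldNormedType.Exports.
Local Open Scope classical_set_scope.
Local Open Scope ring_scope.

Section Defs.
Context {R : realType} {disp : measure_display} {Omega : measurableType disp}.

Definition process (d : nat) := 'I_d -> R -> Omega -> R.

Definition measurable_wrt (G : set (set Omega)) (f : Omega -> R) : Prop :=
  forall B : set R, measurable B -> G (f @^-1` B).

Definition complete_prob (P : probability Omega R) : Prop :=
  forall N A : set Omega, measurable A -> P A = 0%E -> N `<=` A -> measurable N.

Definition usual_filtration (P : probability Omega R) (T : R)
    (F : R -> set (set Omega)) : Prop :=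
  [/\ (forall t, t \in `[0, T] ->
         sigma_algebra setT (F t) /\ F t `<=` measurable),
      (forall s t, s \in `[0, T] -> t \in `[0, T] -> s <= t -> F s `<=` F t),
      F T = measurable,
      (forall t N, t \in `[0, T] -> measurable N -> P N = 0%E -> F t N) &
      (forall t, t \in `[0, T[ ->
         F t = [set A | forall s, s \in `]t, T] -> F s A])].

Definition adapted (T : R) (F : R -> set (set Omega)) d (S : process d) : Prop :=
  forall i t, t \in `[0, T] -> measurable_wrt (F t) (S i t).

Definition maxnorm d (x : 'I_d -> R) : R := \big[Num.max/0]_(i < d) `|x i|.

Definition Sstar (T : R) d (S : process d) (t : R) (omega : Omega) : R :=
  sup [set maxnorm (fun i => S i u omega - S i t omega) | u in `[t, T]].

Definition cond_prob_version (P : probability Omega R) (G : set (set Omega))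
    (A : set Omega) (Y : Omega -> R) : Prop :=
  [/\ measurable_wrt G Y,
      P.-integrable setT (EFin \o Y) &
      forall B, G B -> (\int[P]_(x in B) (Y x)%:E = P (A `&` B))%E].

Definition sticky (P : probability Omega R) (T : R) (F : R -> set (set Omega))
    d (S : process d) : Prop :=
  forall t delta, t \in `[0, T[ -> 0 < delta ->
    exists Y : Omega -> R,
      cond_prob_version P (F t) [set w | Sstar T S t w < delta] Y /\
      {ae P, forall w, 0 < Y w}.

Definition equiv_prob (Q P : probability Omega R) : Prop :=
  forall A, measurable A -> (P A = 0%E <-> Q A = 0%E).

Definition martingale (Q : probability Omega R) (T : R)
    (F : R -> set (set Omega)) d (M : process d) : Prop :=
  adapted T F M /\
  forall i,
    (forall t, t \in `[0, T] -> Q.-integrable setT (EFin \o M i t)) /\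
    (forall s t, s \in `[0, T] -> t \in `[0, T] -> s <= t ->
       forall B, F s B ->
         (\int[Q]_(x in B) (M i t x)%:E = \int[Q]_(x in B) (M i s x)%:E)%E).

Definition eps_CPS (P : probability Omega R) (T : R) (F : R -> set (set Omega))
    d (S : process d) (eps : R) (M : process d) : Prop :=
  [/\ adapted T F M,
      (forall i t, t \in `[0, T] ->
         {ae P, forall w, S i t w / (1 + eps) <= M i t w <= (1 + eps) * S i t w}) &
      exists Q : probability Omega R, equiv_prob Q P /\ martingale Q T F M].

End Defs.

(* Main.v *)
(** Call the [n]-th move of a path the first time after the [(n-1)]-th move at
    which some coordinate has oscillated by a factor [rho > 1]; continuous paths
    make finitely many moves.  By stickiness, given the information at a move, the
    path retires (makes no further move) with positive conditional probability.
    A density that shrinks fast enough with the number of moves yields an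
    equivalent [Q] under which the conditional probability of moving on is at most
    [(rho - 1) / rho^2].  Since [S_T / S_t <= rho^(j+1)] if [j] moves follow after
    [t], a geometric series shows that [M_t = E_Q[S_T | F_t]] stays within a factor
    [rho^4] of [S_t]. *)
Require Import Defs.
From HB Require Import structures.
From mathcomp Require Import all_boot all_order all_algebra.
From mathcomp Require Import all_classical all_reals all_analysis.
From mathcomp Require Import measurable_realfun ring lra.
Set Implicit Arguments. Unset Strict Implicit. Unset Printing Implicit Defensive.
Import Order.TTheory GRing.Theory Num.Theory.
Import numFieldNormedType.Exports.
Local Open Scope classical_set_scope.
Local Open Scope ring_scope.

(** Stickiness speaks of deterministic times and gives no lower bound on the probability of
    retiring. To pass to the random times of moves, no such time is made a random variable: only the
    events that the [n]-th move precedes [t] occur. A path that has just moved is caught at a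
    rational time at which it has since oscillated by at most a factor [sqrt rho]. If it then stays
    close to its value at that time, it oscillates by at most another such factor, [rho] in all, and
    makes no further move. Since the chance of retiring may be arbitrarily small, the density is not
    a function of the number of moves alone: each weight is compared with a conditional mass that
    depends on the path. Of the four factors [rho], three bound [E_Q[S_T | F_t]] on an event where
    [S_t] is bounded by a constant, and the fourth is the price of cutting the values of [S_t] into
    intervals [[a, rho * a[]. *)

Section Path.
Context {R : realType} {d : nat}.
Implicit Types (x : 'I_d -> R -> R) (E : R -> Prop) (n : nat).

(** The times [u] and [v] are not ordered, so a single inequality covers rises and falls. *)
Definition moved (r : R) x E (t : R) : Prop :=
  exists u v i, [/\ 0 <= u <= t, 0 <= v <= t, E u, E v & r * x i v < x i u].

(* [reach r x n t] says that the [n]-th move happens strictly before [t].  The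
   strict form makes this an open condition in [t], so that it can be tested on
   rational times and belongs to [F_t]. *)
Fixpoint reach (r : R) x n (t : R) : Prop :=
  if n is m.+1 then moved r x (reach r x m) t else True.

Lemma not_moved r x E t : ~ moved r x E t ->
  forall u v i, 0 <= u <= t -> 0 <= v <= t -> E u -> E v -> x i u <= r * x i v.
Proof.
move=> nm u v i ut vt Eu Ev; rewrite leNgt; apply/negP => h; apply: nm.
by exists u, v, i.
Qed.

Lemma moved_le r x E s t : s <= t -> moved r x E s -> moved r x E t.
Proof.
move=> st [u [v [i [/andP[u0 us] /andP[v0 vs] Eu Ev h]]]]; exists u, v, i; split => //.
  by rewrite u0 (le_trans us).
by rewrite v0 (le_trans vs).
Qed.

Lemma reach_le r x n s t : s <= t -> reach r x n s -> reach r x n t.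
Proof. by case: n => // n; exact: moved_le. Qed.

Lemma reachS r x n t : reach r x n.+1 t -> reach r x n t.
Proof. by move=> [u [_ [_ [/andP[_ ut] _ Eu _ _]]]]; exact: reach_le ut Eu. Qed.

Lemma reach_anti r x m n t : (m <= n)%N -> reach r x n t -> reach r x m t.
Proof.
move=> /subnK <-; elim: (n - m)%N => // k IH; rewrite addSn => /reachS; exact: IH.
Qed.

(** Clamped rationals are dense in [[0, t]] for every real [t], and their index set does not depend
    on [t]. *)
Definition clamp (t u : R) : R := Num.max 0 (Num.min t u).

Lemma clamp_itv t u : 0 <= t -> 0 <= clamp t u <= t.
Proof. by rewrite /clamp; case: (leP t u) => ?; [case: (leP 0 t)|case: (leP 0 u)] => ?; lra. Qed.

Lemma clamp_dense (t u e : R) : 0 <= u <= t -> 0 < e ->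
  exists q : rat, `|clamp t (ratr q) - u| < e.
Proof.
move=> ut e0; have /rat_in_itvoo[q] : u - e < u + e by lra.
rewrite in_itv /= => qu; exists q.
by rewrite ltr_norml /clamp; case: (leP t (ratr q)) => ?;
  [case: (leP 0 t)|case: (leP 0 (ratr q))] => ?; lra.
Qed.

(** * Moves of a continuous positive path *)

Section Continuous.
Variables (T : R) (x : 'I_d -> R -> R).
Hypothesis cx : forall i, {within `[0, T], continuous (x i)}.
Hypothesis x0 : forall i (t : R), 0 <= t <= T -> 0 < x i t.

Lemma path_continuous i (s e : R) : 0 <= s <= T -> 0 < e ->
  exists2 eta, 0 < eta & forall u, 0 <= u <= T -> `|u - s| < eta ->
    `|x i u - x i s| < e.
Proof.
move=> sT e0; have /subspace_continuousP/(_ s) := @cx i.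
rewrite /= in_itv /= => /(_ sT) /cvgrPdist_lt/(_ e e0).
move=> /nbhs_ballP[eta /= eta0 h].
exists eta => // u uT us; rewrite distrC; apply: h; last by rewrite in_itv.
by rewrite /ball/= distrC.
Qed.

Lemma moved_open (r : R) i (u v : R) : 0 < r -> 0 <= u <= T -> 0 <= v <= T ->
  r * x i v < x i u ->
  exists2 eta, 0 < eta & forall u' v', 0 <= u' <= T -> 0 <= v' <= T ->
    `|u' - u| < eta -> `|v' - v| < eta -> r * x i v' < x i u'.
Proof.
move=> r0 uT vT h.
pose e := (x i u - r * x i v) / 2.
have e0 : 0 < e by rewrite /e; lra.
have [e1 e10 h1] := path_continuous i uT e0.
have er0 : 0 < e / r by rewrite divr_gt0.
have [e2 e20 h2] := path_continuous i vT er0.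
exists (Num.min e1 e2); first by rewrite lt_min e10.
move=> u' v' u'T v'T; rewrite !lt_min => /andP[/(h1 _ u'T) + _] /andP[_ /(h2 _ v'T)].
rewrite !ltr_norml => /andP[a1 _] /andP[_]; rewrite ltr_pdivlMr// => b2.
rewrite /e in a1 b2; lra.
Qed.

Lemma locally_close (r s : R) : 1 < r -> 0 <= s <= T ->
  exists2 eta, 0 < eta & forall u v i, 0 <= u <= T -> 0 <= v <= T ->
    `|u - s| < eta -> `|v - s| < eta -> x i u <= r * x i v.
Proof.
move=> r1 sT.
have r0 : 0 < r by lra.
have H i : exists e, 0 < e /\ forall u v, 0 <= u <= T -> 0 <= v <= T ->
    `|u - s| < e -> `|v - s| < e -> x i u <= r * x i v.
  have xs := @x0 i s sT.
  have h : r^-1 * x i s < x i s by rewrite gtr_pMl// invf_lt1.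
  have [e e0 he] : exists2 e, 0 < e & forall u v, 0 <= u <= T -> 0 <= v <= T ->
    `|u - s| < e -> `|v - s| < e -> r^-1 * x i u < x i v.
    have [e e0 he] := moved_open (u := s) (v := s) (r := r^-1) ltac:(by rewrite invr_gt0) sT sT h.
    by exists e => // u v uT vT us vs; exact: he.
  exists e; split => // u v uT vT us vs.
  by have /ltW := he u v uT vT us vs; rewrite ler_pdivrMl.
have [f fP] := choice H.
(* The base value [1] keeps the radius positive when there are no coordinates. *)
exists (\big[Num.min/1]_i f i).
  by apply: lt_bigmin => // i _; have [] := fP i.
move=> u v i uT vT us vs.
by have [_] := fP i; apply => //; [apply: lt_le_trans us _|apply: lt_le_trans vs _];
  exact: bigmin_le.
Qed.

Definition path_open E : Prop := forall t, 0 <= t <= T -> E t ->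
  exists2 eta, 0 < eta & forall s, 0 <= s <= T -> `|s - t| < eta -> E s.

Lemma moved_near (r : R) E i (u v : R) : 0 < r -> path_open E ->
  0 <= u <= T -> 0 <= v <= T -> E u -> E v -> r * x i v < x i u ->
  exists2 eta, 0 < eta & forall u' v', 0 <= u' <= T -> 0 <= v' <= T ->
    `|u' - u| < eta -> `|v' - v| < eta -> [/\ E u', E v' & r * x i v' < x i u'].
Proof.
move=> r0 oE uT vT Eu Ev h.
have [e1 e10 h1] := moved_open r0 uT vT h.
have [e2 e20 h2] := oE u uT Eu.
have [e3 e30 h3] := oE v vT Ev.
exists (Num.min e1 (Num.min e2 e3)); first by rewrite !lt_min e10 e20.
move=> u' v' u'T v'T; rewrite !lt_min => /and3P[a1 a2 _] /and3P[b1 _ b3].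
by split; [exact: h2|exact: h3|exact: h1].
Qed.

Lemma path_open_moved (r : R) E : 0 < r -> path_open E -> path_open (moved r x E).
Proof.
move=> r0 oE t tT [u [v [i [ut vt Eu Ev h]]]].
have uT : 0 <= u <= T by lra.
have vT : 0 <= v <= T by lra.
have [e e0 he] := moved_near r0 oE uT vT Eu Ev h.
have key w s : 0 <= w <= t -> 0 <= s <= T -> `|s - t| < e ->
    0 <= Num.min w s <= s /\ `|Num.min w s - w| < e.
  move=> wt sT; rewrite !ltr_norml; case: (leP w s) => ws; lra.
(* A witness may be as late as [t]. For [s] below [t] it is pulled back to [s], a shift of at most
   [t - s]. *)
exists e => // s sT st; exists (Num.min u s), (Num.min v s), i.
have [us ud] := key u s ut sT st; have [vs vd] := key v s vt sT st.
have [] := he (Num.min u s) (Num.min v s) _ _ ud vd; last by [].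
- lra.
- lra.
Qed.

Lemma path_open_reach (r : R) n : 0 < r -> path_open (reach r x n).
Proof.
move=> r0; elim: n => [t _ _|n IH]; first by exists 1.
exact: path_open_moved.
Qed.

(** The supremum of the times at which [E] fails is itself such a time, because [E] is open. With
    [E] the event of a move, [s] is the time of that move. *)
Lemma last_exit E t : path_open E -> (forall s u, s <= u -> E s -> E u) ->
  0 <= t <= T -> ~ E t -> E T ->
  exists s, [/\ t <= s, s < T, ~ E s & forall u, s < u <= T -> E u].
Proof.
move=> oE upE tT nEt ET.
pose A := [set u | t <= u <= T /\ ~ E u].
have At : A t by split => //; lra.
have ubA : ubound A T by move=> u [/andP[]].
have hA : has_sup A by split; [exists t|exists T].
pose s := sup A.
have ts : t <= s by apply: ub_le_sup => //; exists T.
have sT : s <= T by apply: ge_sup => //; exists t.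
have nEs : ~ E s.
  move=> Es; have [|e e0 he] := oE s _ Es; first lra.
  have [u [uT nEu] su] := sup_adherent e0 hA.
  have us : u <= s by apply: ub_le_sup => //; exists T.
  apply: nEu; apply: he; first lra.
  rewrite ltr_norml -/s in su *; lra.
exists s; split => //.
  by rewrite lt_neqAle sT andbT; apply/eqP => sE; apply: nEs; rewrite sE.
move=> u /andP[su uT]; apply: contrapT => nEu.
suff : u <= s by rewrite leNgt su.
by apply: ub_le_sup; [exists T|split => //; lra].
Qed.

(** Let [s] be the supremum of the times preceded by finitely many moves. Near [s] the path
    oscillates by at most [r], so at most one more move fits between a time [t] just before [s] and
    a time [t'] just after it; hence [s] can only be [T]. *)
Lemma reach_finite (r : R) : 1 < r -> 0 <= T -> exists n, ~ reach r x n T.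
Proof.
move=> r1 T0.
pose A := [set t | 0 <= t <= T /\ exists n, ~ reach r x n t].
have A0 : A 0.
  split; first lra.
  exists 1%N => -[u [v [i [u0 v0 _ _]]]].
  have -> : u = 0 by lra.
  have -> : v = 0 by lra.
  have x00 : 0 < x i 0 by apply: x0; lra.
  nra.
have ubA : ubound A T by move=> u [/andP[]].
have hA : has_sup A by split; [exists 0|exists T].
pose s := sup A.
have s0 : 0 <= s by apply: ub_le_sup => //; exists T.
have sT : s <= T by apply: ge_sup => //; exists 0.
have [|e e0 he] := @locally_close r s r1; first lra.
have [t At st] := sup_adherent e0 hA; rewrite -/s in st; have [tT [n nt]] := At.
have ts : t <= s by apply: ub_le_sup => //; exists T.
pose t' := Num.min T (s + e / 2).
have At' : A t'.
  split; first by rewrite /t'; case: (leP T (s + e / 2)) => ?; lra.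
  exists n.+1 => -[u [v [i [ut vt ru rv]]]].
  have tu : t < u by rewrite ltNge; apply/negP => ut0; apply: nt; exact: reach_le ut0 ru.
  have tv : t < v by rewrite ltNge; apply/negP => vt0; apply: nt; exact: reach_le vt0 rv.
  apply/negP; rewrite -leNgt; apply: he.
  - by move: ut; rewrite /t'; case: (leP T (s + e / 2)) => ?; lra.
  - by move: vt; rewrite /t'; case: (leP T (s + e / 2)) => ?; lra.
  - by move: ut; rewrite /t' ltr_norml; case: (leP T (s + e / 2)) => ?; lra.
  - by move: vt; rewrite /t' ltr_norml; case: (leP T (s + e / 2)) => ?; lra.
have t's : t' <= s by apply: ub_le_sup => //; exists T.
case: At' => _ [m]; rewrite (_ : t' = T); first by exists m.
by move: t's; rewrite /t'; case: (leP T (s + e / 2)) => ?; lra.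
Qed.

(** The strict form of [reach] controls the path only after the time [t] of a move; continuity
    extends the comparison to [t] itself. *)
Lemma close_left (r : R) i (t s : R) : 0 < r -> 0 <= t -> t < s -> s <= T ->
  (forall u, t < u <= s -> x i u <= r * x i s /\ x i s <= r * x i u) ->
  x i t <= r * x i s /\ x i s <= r * x i t.
Proof.
move=> r0 t0 ts sT h.
have tT : 0 <= t <= T by lra.
have sT' : 0 <= s <= T by lra.
split; rewrite leNgt; apply/negP => k.
- have [e e0 he] := moved_open r0 tT sT' k.
  pose u := Num.min s (t + e / 2).
  have [] := h u; first by rewrite /u; case: (leP s (t + e / 2)) => ?; lra.
  rewrite leNgt he //.
  + by rewrite /u; case: (leP s (t + e / 2)) => ?; lra.
  + by rewrite ltr_norml /u; case: (leP s (t + e / 2)) => ?; lra.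
  + by rewrite subrr normr0.
- have [e e0 he] := moved_open r0 sT' tT k.
  pose u := Num.min s (t + e / 2).
  have [] := h u; first by rewrite /u; case: (leP s (t + e / 2)) => ?; lra.
  rewrite [in X in _ -> X -> _]leNgt he //.
  + by rewrite /u; case: (leP s (t + e / 2)) => ?; lra.
  + by rewrite subrr normr0.
  + by rewrite ltr_norml /u; case: (leP s (t + e / 2)) => ?; lra.
Qed.

(** The first hypothesis looks only at times after [t], so that [t] may be the very time of the
    [n]-th move. The induction jumps to the time [s] of the next move at the cost of one factor [r];
    the last stretch up to [T] costs one more, hence the exponent [j.+1]. *)
Lemma reach_close (r : R) j n t i : 1 < r -> 0 <= t <= T ->
  (forall u, t < u <= T -> reach r x n u) -> ~ reach r x n.+1 t ->
  ~ reach r x (n + j).+1 T ->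
  x i t <= r ^+ j.+1 * x i T /\ x i T <= r ^+ j.+1 * x i t.
Proof.
move=> r1.
have r0 : 0 < r by lra.
elim: j n t => [|j IH] n t tT rn nr nT.
  rewrite expr1; rewrite addn0 in nT.
  have [tT'|Tt] := ltP t T; last first.
    have -> : t = T by lra.
    have := @x0 i T; nra.
  apply: close_left => //; try lra.
  by move=> u uT; split; apply: (not_moved nT); try lra; apply: rn; lra.
have [rT|nrT] := pselect (reach r x n.+1 T); last first.
  have nT' : ~ reach r x (n + j).+1 T.
    by move=> h; apply: nrT; apply: reach_anti h; rewrite ltnS leq_addr.
  have xt := @x0 i t tT.
  have xT : 0 < x i T by apply: x0; lra.
  have [h1 h2] := IH n t tT rn nr nT'; rewrite (exprS _ j.+1) -!mulrA; split.
    by apply: (le_trans h1); rewrite ler_peMl ?mulr_ge0 ?exprn_ge0 ?ltW.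
  by apply: (le_trans h2); rewrite ler_peMl ?mulr_ge0 ?exprn_ge0 ?ltW.
have [s [ts sT ns hs]] := last_exit (@path_open_reach r n.+1 r0)
  (fun a b => @reach_le r x n.+1 a b) tT nr rT.
have s0T : 0 <= s <= T by lra.
have xs := @x0 i s s0T.
have [|h1 h2] := IH n.+1 s s0T hs (fun h => ns (reachS h)); first by rewrite addSnnS.
suff [k1 k2] : x i t <= r * x i s /\ x i s <= r * x i t.
  rewrite (exprS _ j.+1) -!mulrA; split.
    by apply: (le_trans k1); rewrite ler_pM2l.
  apply: (le_trans h2); rewrite mulrCA ler_pM2l// exprn_gt0//.
have [ts'|st] := ltP t s; last first.
  have -> : t = s by lra.
  nra.
apply: close_left => //; try lra.
by move=> u uT; split; apply: (not_moved ns); try lra; apply: rn; lra.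
Qed.

(** Just after the [n]-th move continuity keeps the oscillation below any [r > 1], and a rational
    fits into that stretch. Being deterministic, it is a time at which stickiness applies. *)
Lemma reach_quiet (r rho : R) n : 1 < r -> 0 < rho -> 0 < T -> reach rho x n T ->
  exists q : rat, [/\ 0 <= clamp T (ratr q) < T, reach rho x n (clamp T (ratr q))
    & ~ moved r x (reach rho x n) (clamp T (ratr q))].
Proof.
move=> r1 rho0 T0 rT; have [r00|nr0] := pselect (reach rho x n 0).
  have c0 : clamp T (ratr 0) = 0.
    by rewrite /clamp rmorph0; case: (leP T 0) => ?; [lra|case: (leP 0 0) => ?; lra].
  exists 0; rewrite c0; split => //; first lra.
  move=> [u [v [i [u0 v0 _ _]]]].
  have -> : u = 0 by lra.
  have -> : v = 0 by lra.
  have x00 : 0 < x i 0 by apply: x0; lra.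
  nra.
have zT : 0 <= (0 : R) <= T by rewrite lexx ltW.
have [s [s0 sT ns hs]] := @last_exit _ 0 (@path_open_reach rho n rho0)
  (fun a b => @reach_le rho x n a b) zT nr0 rT.
have [|e e0 he] := @locally_close r s r1; first lra.
pose m := Num.min T (s + e).
have [sm [mT me]] : s < m /\ m <= T /\ m <= s + e.
  by rewrite /m; case: (leP T (s + e)) => ?; lra.
have mid : 0 <= (s + m) / 2 <= T by lra.
(* The ball around the midpoint with this radius is exactly the open interval from [s] to [m]. *)
have [|q] := @clamp_dense _ _ ((m - s) / 2) mid; first lra.
rewrite ltr_norml; set c := clamp _ _ => cq.
exists q; rewrite -/c; split; [lra|by apply: hs; lra|].
move=> [u [v [i [uc vc ru rv]]]]; apply/negP; rewrite -leNgt.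
have su : s < u by rewrite ltNge; apply/negP => us; apply: ns; exact: reach_le us ru.
have sv : s < v by rewrite ltNge; apply/negP => vs; apply: ns; exact: reach_le vs rv.
by apply: he; rewrite ?ltr_norml; lra.
Qed.

(** Openness lets both witnesses be shifted to clamped rationals; the event thus becomes a countable
    union, which gives its measurability. *)
Lemma moved_ratP (r : R) E t : 0 < r -> path_open E -> 0 <= t <= T ->
  moved r x E t <-> exists p q i,
    [/\ E (clamp t (ratr p)), E (clamp t (ratr q))
      & r * x i (clamp t (ratr q)) < x i (clamp t (ratr p))].
Proof.
move=> r0 oE tT; have t0 : 0 <= t by lra.
split=> [[u [v [i [ut vt Eu Ev h]]]]|[p [q [i [Ep Eq h]]]]]; last first.
  by exists (clamp t (ratr p)), (clamp t (ratr q)), i; split => //; exact: clamp_itv.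
have uT : 0 <= u <= T by lra.
have vT : 0 <= v <= T by lra.
have [e e0 he] := moved_near r0 oE uT vT Eu Ev h.
have [p pu] := clamp_dense ut e0; have [q qv] := clamp_dense vt e0.
exists p, q, i; apply: he => //.
  by have := clamp_itv (ratr p) t0; lra.
by have := clamp_itv (ratr q) t0; lra.
Qed.

End Continuous.

End Path.

(** * Sub-sigma-algebras and conditional expectation *)

Section SubSigmaAlgebra.
Context {R : realType} {disp : measure_display} {Omega : measurableType disp}.
Implicit Types (P : probability Omega R) (G : set (set Omega)) (h k : Omega -> R).

Lemma measurable_wrtP G (f : Omega -> R) : sigma_algebra setT G ->
  measurable_wrt G f <-> measurable_fun setT (f : g_sigma_algebraType G -> R).
Proof.
move=> sG; split=> [mf _ B mB|mf B mB].
  by rewrite setTI measurable_g_measurableTypeE//; exact: mf.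
by have := mf measurableT B mB; rewrite setTI measurable_g_measurableTypeE.
Qed.

Lemma sub_sigma_algebraI G A B : sigma_algebra setT G -> G A -> G B -> G (A `&` B).
Proof. by move=> sG; rewrite -(measurable_g_measurableTypeE sG); exact: measurableI. Qed.

Lemma sub_sigma_algebraC G A : sigma_algebra setT G -> G A -> G (~` A).
Proof. by move=> sG; rewrite -(measurable_g_measurableTypeE sG); exact: measurableC. Qed.

Lemma sub_sigma_algebra_bigcup G (I : Type) (F : I -> set Omega) :
  sigma_algebra setT G -> countable [set: I] ->
  (forall i, G (F i)) -> G (\bigcup_i F i).
Proof.
move=> sG cI; rewrite -(measurable_g_measurableTypeE sG) => mF.
exact: (@countable_bigcupT_measurable _ (g_sigma_algebraType G)).
Qed.

(** The conditional expectation is the Radon-Nikodym derivative, on the space equipped with [G], of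
    the charge with density [h] with respect to [P]. *)
Lemma cond_exp P G h : sigma_algebra setT G -> G `<=` measurable ->
  P.-integrable setT (EFin \o h) ->
  exists k, [/\ measurable_wrt G k, P.-integrable setT (EFin \o k) &
    forall B, G B -> (\int[P]_(x in B) (k x)%:E = \int[P]_(x in B) (h x)%:E)%E].
Proof.
move=> sG Gm ih.
pose T' := g_sigma_algebraType G.
have mE : (measurable : set (set T')) = G by exact: measurable_g_measurableTypeE.
(* The identity into the coarser space is measurable, and the image of [P] under it is the
   restriction of [P] to [G]. *)
have mid : measurable_fun [set: Omega] (id : Omega -> T').
  by move=> _ B; rewrite mE setTI preimage_id; exact: Gm.
pose idm : {mfun Omega >-> T'} := HB.pack (id : Omega -> T')
  (isMeasurableFun.Build _ _ _ _ _ mid).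
pose mu : probability T' R := distribution P idm.
pose nu0 : {charge set Omega -> \bar R} := induced_charge ih.
pose nu := (fun A : set T' => nu0 A).
have n0 : nu set0 = 0%E by exact: charge0.
have nf A : measurable A -> nu A \is a fin_num.
  by rewrite mE => /Gm; exact: fin_num_measure.
have ns : semi_sigma_additive nu.
  move=> A; rewrite mE => mA tA mUA; apply: charge_semi_sigma_additive => //.
    by move=> i; exact/Gm.
  exact/Gm.
pose nuc : {charge set T' -> \bar R} := HB.pack nu (isCharge.Build _ _ _ nu n0 nf ns).
have null (A : set Omega) : measurable A -> P A = 0%E -> nu0 A = 0%E.
  move=> mA PA0; apply: null_set_integral => //.
  by apply: measurable_funTS; exact: measurable_int ih.
have dom : nuc `<< mu.
  by apply/null_content_dominatesP => A; rewrite mE => /Gm mA; exact: null.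
pose g := Radon_Nikodym nuc mu.
have gf x : g x \is a fin_num by exact: Radon_Nikodym_fin_num.
have gi : mu.-integrable setT g by exact: Radon_Nikodym_integrable.
pose k (w : Omega) := fine (g w).
have kE : EFin \o k = g by apply/funext => w; rewrite /= fineK.
have ik : P.-integrable setT (EFin \o k).
  have [mg ig] := integrableP _ _ _ gi.
  apply/integrableP; split; rewrite kE.
    exact: (measurableT_comp mg mid).
  by move: ig; rewrite ge0_integral_pushforward//; exact: measurableT_comp.
exists k; split => //.
  apply/measurable_wrtP => //; apply/measurable_EFinP; rewrite kE.
  exact: measurable_int gi.
move=> B GB; have mB := Gm _ GB.
have mB' : measurable (B : set T') by rewrite mE.
under eq_integral do rewrite -[(k _)%:E]/((EFin \o k) _) kE.
have RN : nu0 B = (\int[mu]_(x in (B : set T')) g x)%E := Radon_Nikodym_integral dom mB'.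
rewrite -[RHS]/(nu0 B) RN integral_pushforward//; first by exact: measurable_int gi.
by rewrite -kE; exact: integrableS ik.
Qed.

End SubSigmaAlgebra.

(** * Integrals of real-valued functions *)

Section RealIntegrals.
Context {R : realType} {disp : measure_display} {Omega : measurableType disp}.
Variable P : {measure set Omega -> \bar R}.
Implicit Types (f g : Omega -> R) (B C : set Omega).
Local Notation I f B := (\int[P]_(x in B) (f x)%:E)%E.

Lemma measurable_lt f g : measurable_fun setT f -> measurable_fun setT g ->
  measurable [set x | f x < g x].
Proof.
move=> mf mg; rewrite (_ : [set x | _] = ~` [set x | g x <= f x]).
  by apply: measurableC; rewrite -[X in measurable X]setTI; exact: measurable_fun_le.
by apply/seteqP; split => x /=; rewrite ltNge => /negP.
Qed.

Lemma le_integral_EFin B f g : measurable B -> measurable_fun B f -> measurable_fun B g ->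
  (forall x, B x -> 0 <= f x <= g x) -> (I f B <= I g B)%E.
Proof.
move=> mB mf mg fg; apply: ge0_le_integral => //.
- by move=> x /fg/andP[f0 _]; rewrite lee_fin.
- exact/measurable_EFinP.
- exact/measurable_EFinP.
- by move=> x /fg/andP[_ ?]; rewrite lee_fin.
Qed.

Lemma subset_integral_EFin B C f : measurable B -> measurable C -> measurable_fun C f ->
  (forall x, C x -> 0 <= f x) -> B `<=` C -> (I f B <= I f C)%E.
Proof.
move=> mB mC mf f0 BC; apply: ge0_subset_integral => //; exact/measurable_EFinP.
Qed.

Lemma integral_le0_EFin B f : (forall x, B x -> f x <= 0) -> (I f B <= 0)%E.
Proof.
move=> f0; rewrite (_ : I f B = - I (fun x => - f x)%R B)%E; last first.
  rewrite -integral_ge0N; last by move=> x /f0 fx; rewrite lee_fin oppr_ge0.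
  by apply: eq_integral => x _; rewrite EFinN oppeK.
by rewrite oppe_le0 integral_ge0// => x /f0 fx; rewrite lee_fin oppr_ge0.
Qed.

Lemma integral_patch_EFin B C f : I f (B `&` C) = I (f \_ C) B.
Proof.
by rewrite integral_mkcondr; apply: eq_integral => x _; rewrite -[RHS]/((EFin \o (f \_ C)) x) -restrict_EFin.
Qed.

Lemma integral_eq0_pos B f : measurable B -> measurable_fun B f ->
  (forall x, B x -> 0 <= f x) -> I f B = 0%E -> P.-negligible (B `&` [set x | 0 < f x]).
Proof.
move=> mB mf f0 If.
have [N [mN N0 sub]] : ae_eq P B (EFin \o f) (cst 0%E).
  apply/ae_eq_integral_abs => //; first exact/measurable_EFinP.
  by rewrite -[RHS]If; apply: eq_integral => x /[!inE] Bx; rewrite /= ger0_norm// f0.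
exists N; split => // x [Bx fx]; apply: sub => /= /(_ Bx) [fx0].
by move: fx; rewrite /= fx0 ltxx.
Qed.

End RealIntegrals.

(** * An equivalent measure that favours retiring *)

Section RetiringMeasure.
Context {R : realType} {disp : measure_display} {Omega : measurableType disp}.
Variables (P : probability Omega R) (E : nat -> set Omega)
  (G : nat -> set (set Omega)) (w0 : Omega -> R) (c : R).
(** [stuck] is the positivity of the conditional probability of retiring, phrased through null sets:
    an event known at stage [n] on which almost nobody retires is null. *)
Hypotheses (c01 : 0 < c <= 1)
  (sG : forall n, sigma_algebra setT (G n))
  (Gm : forall n, G n `<=` measurable)
  (E0 : E 0%N = setT) (Edec : forall n, E n.+1 `<=` E n)
  (Efin : forall w, exists n, ~ E n w)
  (GE : forall n, G n (E n))
  (stuck : forall n B, G n B -> B `<=` E n -> P (B `\` E n.+1) = 0%E -> P B = 0%E)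
  (mw0 : measurable_fun setT w0) (w01 : forall x, 0 < w0 x <= 1).
Local Notation I f B := (\int[P]_(x in B) (f x)%:E)%E.
Local Notation A n := (E n `\` E n.+1).

Let mE n : measurable (E n). Proof. exact: Gm (GE n). Qed.

Let mA n : measurable (A n). Proof. exact: measurableD. Qed.

Let anti_E m n : (m <= n)%N -> E n `<=` E m.
Proof.
move=> /subnK <-; elim: (n - m)%N => // k IH; rewrite addSn.
exact: subset_trans (@Edec _) IH.
Qed.

(* The density is [w n] on the event of retiring after exactly [n] moves.  The
   next weight is at most [c] times the conditional mass of retiring now, so that
   retiring is conditionally likelier than moving on. *)
Let weights : exists w : nat -> Omega -> R, exists k : nat -> Omega -> R,
  w 0%N = w0 /\ forall n, [/\
    w n.+1 = (fun x => c * Num.min (w n x) (Num.max 0 (k n x))),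
    measurable_fun setT (w n), (forall x, 0 <= w n x <= 1), measurable_wrt (G n) (k n) &
    forall B, G n B -> I (k n) B = I (w n) (B `&` A n)].
Proof.
have H (p : nat * (Omega -> R)) : exists k, measurable_fun setT p.2 ->
    (forall x, 0 <= p.2 x <= 1) -> measurable_wrt (G p.1) k /\
    forall B, G p.1 B -> I k B = I p.2 (B `&` A p.1).
  (* [choice] asks for a value at every pair, also at functions that are no weights; these receive
     [0]. *)
  have [[mp p01]|np] := pselect (measurable_fun setT p.2 /\ forall x, 0 <= p.2 x <= 1);
    last by exists (cst 0) => mp p01; exfalso; apply: np.
  have ip : P.-integrable setT (EFin \o (p.2 \_ (A p.1))).
    apply: measurable_bounded_integrable => //.
    - by apply: (le_lt_trans (probability_le1 P measurableT)); rewrite ltry.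
    - by apply/(measurable_restrictT _ (mA p.1)); exact: measurable_funTS.
    - exists 1; split => // M M1 x _; rewrite /= patchE; case: ifP => _.
        by have /andP[p0 p1] := p01 x; rewrite ger0_norm// (le_trans p1)// ltW.
      by rewrite normr0 ltW// (lt_trans _ M1).
  have [k [mk ik kE]] := cond_exp (sG p.1) (@Gm p.1) ip.
  by exists k => _ _; split => // B GB; rewrite kE// integral_patch_EFin.
have [K KP] := choice H.
pose w := fix w n := if n is m.+1 then
  fun x => c * Num.min (w m x) (Num.max 0 (K (m, w m) x)) else w0.
have wP n : measurable_fun setT (w n) /\ forall x, 0 <= w n x <= 1.
  elim: n => [|n [mw w1]]; first by split => // x; have /andP[/ltW ? ?] := w01 x; apply/andP.
  have [mk _] := KP (n, w n) mw w1.
  have mk' : measurable_fun setT (K (n, w n)).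
    by move=> _ B mB; rewrite setTI; apply/Gm/mk.
  split.
    by apply: measurable_funM => //; apply: measurable_minr => //; exact: measurable_maxr.
  move=> x; have /andP[a0 a1] := w1 x; have /andP[c0 c1] := c01.
  rewrite mulr_ge0 ?le_min ?a0 ?le_max ?lexx ?(ltW c0)//=.
  by rewrite mulr_ile1 ?ge_min ?a1 ?le_min ?a0 ?le_max ?lexx ?(ltW c0).
exists w, (fun n => K (n, w n)); split => // n.
have [mw w1] := wP n; have [mk kE] := KP (n, w n) mw w1.
by split.
Qed.

(** The density of [Q] is [Z], the weight at the stage of retirement, divided by its total mass
    [1 / H]. Those who move on carry at most [w n.+1], hence at most [c] times the positive part of
    [k n]; the integral of [k n] is the mass of [w n], equal to [Z], on those who retire now. The
    last bound holds because the weights decrease from [w0]. *)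
Lemma retiring_measure : exists (Q : probability Omega R) (H : R), [/\ 0 <= H,
  equiv_prob Q P,
  (forall n C, G n C -> C `<=` E n -> (Q (C `&` E n.+1) <= c%:E * Q C)%E) &
  forall C a, measurable C -> 0 <= a -> (forall x, C x -> w0 x <= a) ->
    (Q C <= (H * a)%:E * P C)%E].
Proof.
have [w [k [w00 wk]]] := weights.
have mw n : measurable_fun setT (w n) by have [] := wk n.
have w1 n x : 0 <= w n x <= 1 by have [_ _ + _ _] := wk n; apply.
have wS n x : w n.+1 x = c * Num.min (w n x) (Num.max 0 (k n x)).
  by have [-> _ _ _ _] := wk n.
have mk n : measurable_fun setT (k n).
  by move=> _ B mB; rewrite setTI; have [_ _ _ mk _] := wk n; exact/Gm/mk.
have wdec m n x : (m <= n)%N -> w n x <= w m x.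
  move=> /subnK <-; elim: (n - m)%N => // j IH; rewrite addSn wS.
  apply: le_trans IH; have /andP[a0 _] := w1 (j + m)%N x; have /andP[c0 c1] := c01.
  rewrite (@le_trans _ _ (Num.min (w (j + m)%N x) (Num.max 0 (k (j + m)%N x))))//.
    by rewrite ler_piMl// le_min a0 le_max lexx.
  by rewrite ge_min lexx.
have Aex x : exists n, A n x.
  have [n] := Efin x; elim: n => [|n IH] nEn; first by rewrite E0 in nEn; case: nEn.
  by have [En|/IH//] := pselect (E n x); exists n.
have Auniq m n x : A m x -> A n x -> m = n.
  move=> [Em nEm] [En nEn]; apply/eqP; rewrite eqn_leq; apply/andP.
  split; rewrite leqNgt; apply/negP => mn.
    by apply: nEn; exact: (anti_E mn Em).
  by apply: nEm; exact: (anti_E mn En).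
have [N NA] := choice Aex.
pose Z x := w (N x) x.
have ZA n x : A n x -> Z x = w n x by move=> Ax; rewrite /Z (Auniq _ _ _ (NA x) Ax).
have ZE n x : E n x -> Z x <= w n x.
  move=> Ex; apply: wdec; rewrite leqNgt; apply/negP => Nn.
  by have [_] := NA x; apply; exact: (anti_E Nn Ex).
have Z01 x : 0 <= Z x <= 1 by exact: w1.
have Z0 x : 0 <= Z x by have /andP[] := Z01 x.
have mZ : measurable_fun setT Z.
  have -> : setT = \bigcup_n A n by apply/seteqP; split => // x _; exists (N x).
  apply/measurable_fun_bigcup => // n.
  apply: (@eq_measurable_fun _ _ _ _ _ (w n)); last exact: measurable_funTS.
  by move=> x /[!inE] /ZA.
(* A weight can newly vanish only where [k n <= 0]. There [w n] has no mass on the retiring paths,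
   although it is almost surely positive, so almost nobody retires there and [stuck] applies. *)
have wpos n : P (E n `&` [set x | w n x <= 0]) = 0%E.
  have mwn m : measurable [set x | w m x <= 0].
    by rewrite -[X in measurable X]setTI; exact: measurable_fun_le.
  elim: n => [|n IH].
    rewrite w00 (_ : _ `&` _ = set0) ?measure0//.
    by apply/seteqP; split => // x [_] /=; have := w01 x; lra.
  pose B := E n `&` [set x | k n x <= 0].
  have [_ _ _ mkn kI] := wk n.
  have GB : G n B.
    apply: sub_sigma_algebraI => //; rewrite (_ : [set x | _] = k n @^-1` `]-oo, 0]).
      exact: mkn.
    by apply/seteqP; split => x /=; rewrite in_itv.
  have mB := Gm GB.
  have nB : P.-negligible (B `&` A n `&` [set x | 0 < w n x]).
    apply: integral_eq0_pos.
    - exact: measurableI.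
    - exact: measurable_funTS.
    - by move=> x _; have /andP[] := w1 n x.
    - apply/eqP; rewrite eq_le; apply/andP; split; last first.
        by apply: integral_ge0 => x _; rewrite lee_fin; have /andP[] := w1 n x.
      by rewrite -kI//; apply: integral_le0_EFin => x [].
  have PB : P B = 0%E.
    apply: (@stuck n) => //; first by move=> x [].
    apply/negligibleP; first exact: measurableD.
    have nU := negligibleU nB ((negligibleP P (measurableI _ _ (mE n) (mwn n))).2 IH).
    apply: negligibleS nU => x [[Ex kx] nE]; have [wx|wx] := ltP 0 (w n x).
      by left; split => //; split.
    by right.
  apply/negligibleP; first exact: measurableI.
  have nU := negligibleU ((negligibleP P mB).2 PB)
    ((negligibleP P (measurableI _ _ (mE n) (mwn n))).2 IH).
  apply: negligibleS nU => x [/Edec Ex]; rewrite /= wS pmulr_rle0; last by case/andP: c01.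
  by rewrite ge_min ge_max lexx/= => /orP[wx|kx]; [right|left].
have Zpos : P.-negligible [set x | Z x <= 0].
  have nU : P.-negligible (\bigcup_n (E n `&` [set x | w n x <= 0])).
    apply: negligible_bigcup => n; apply/negligibleP; last exact: wpos.
    apply: measurableI => //; rewrite -[X in measurable X]setTI.
    exact: measurable_fun_le.
  apply: negligibleS nU => x Zx; exists (N x) => //; split => //.
  by have [] := NA x.
have mu0 : I Z set0 = 0%E by rewrite integral_set0.
have mu_ge0 B : (0 <= I Z B)%E by apply: integral_ge0 => x _; rewrite lee_fin.
have mu_sa : semi_sigma_additive (fun B => I Z B).
  apply: semi_sigma_additive_nng_induced => [|x]; last by rewrite lee_fin.
  exact/measurable_EFinP.
pose mu : {measure set Omega -> \bar R} := HB.pack (fun B => I Z B)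
  (isMeasure.Build _ _ _ (fun B => I Z B) mu0 mu_ge0 mu_sa).
have muT1 : (mu setT <= 1)%E.
  rewrite -(probability_setT P) -[leRHS]mul1e -integral_cst//.
  by apply: le_integral_EFin => // x _; exact: measurable_cst.
have muTN0 : mu setT != 0%E.
  apply/eqP => muT0; have := integral_eq0_pos measurableT mZ (fun x _ => Z0 x) muT0.
  move=> /negligibleU /(_ Zpos) nT; suff : P setT = 0%E.
    by rewrite probability_setT => /eqP; rewrite onee_eq0.
  apply/negligibleP => //; apply: negligibleS nT => x _.
  by have [Zx|Zx] := ltP 0 (Z x); [left|right].
pose Q : probability Omega R := mnormalize mu P.
pose H := (fine (mu setT))^-1.
have muTfin : mu setT \is a fin_num.
  by rewrite ge0_fin_numE// (le_lt_trans muT1)// ltry.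
have H0 : 0 < H by rewrite invr_gt0 fine_gt0// lt0e muTN0 mu_ge0/= -ge0_fin_numE.
have QE B : Q B = (I Z B * H%:E)%E.
  rewrite /Q /= /mnormalize (negbTE muTN0)/=.
  by move: muTfin; rewrite fin_numE => /andP[_ /negbTE ->].
exists Q, H; split.
- exact: ltW.
- move=> B mB; rewrite QE; split=> [PB|].
    rewrite null_set_integral ?mul0e//; apply/measurable_EFinP.
    exact: measurable_funTS.
  move=> /eqP; rewrite mule_eq0 eqe (gt_eqF H0) orbF => /eqP.
  move=> /(integral_eq0_pos mB (measurable_funTS mZ) (fun x _ => Z0 x)).
  move=> /negligibleU /(_ Zpos) nT; apply/negligibleP => //.
  apply: negligibleS nT => x Bx.
  by have [Zx|Zx] := ltP 0 (Z x); [left|right].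
- move=> n C GC CE; rewrite !QE muleA; apply: lee_wpmul2r; first by rewrite lee_fin ltW.
  have mC := Gm GC; have [_ _ _ mkn kI] := wk n.
  have kpos : G n (C `&` [set x | 0 < k n x]).
    apply: sub_sigma_algebraI => //; rewrite (_ : [set x | _] = k n @^-1` `]0, +oo[).
      exact: mkn.
    by apply/seteqP; split => x /=; rewrite in_itv/= andbT.
  have kpm := Gm kpos.
  apply: (@le_trans _ _ (I (w n.+1) C)).
    apply: (@le_trans _ _ (I (w n.+1) (C `&` E n.+1))).
      apply: le_integral_EFin; [exact: measurableI| exact: measurable_funTS..|].
      by move=> x [_ /ZE ->]; rewrite Z0.
    apply: subset_integral_EFin => //; [exact: measurableI|exact: measurable_funTS|].
    by move=> x _; have /andP[] := w1 n.+1 x.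
  (* The positive part of [k n] is replaced by [k n] on an event of [G n], where the defining
     identity of [k n] can be used. *)
  have step : (I (w n.+1) C <= c%:E * I (k n) (C `&` [set x | (0 < k n x)%R]))%E.
    have mp : measurable_fun setT (k n \_ [set x | 0 < k n x]).
      have mK : measurable [set x | 0 < k n x] by exact: measurable_lt.
      by apply/(measurable_restrictT _ mK); exact: measurable_funTS.
    have p0 x : 0 <= (k n \_ [set x | 0 < k n x]) x.
      by rewrite patchE; case: ifPn => //; rewrite inE => /ltW.
    rewrite integral_patch_EFin -ge0_integralZl_EFin//.
    - apply: le_integral_EFin => //; first exact: measurable_funTS.
        by apply: measurable_funTS; exact: measurable_funM.
      move=> x _; have /andP[-> _] := w1 n.+1 x; rewrite wS /= ler_pM2l; last by case/andP: c01.
      rewrite ge_min ge_max p0 patchE /=; apply/orP; right.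
      by case: ifPn => //; rewrite notin_setE /= => /negP; rewrite -leNgt.
    - by move=> x _; rewrite lee_fin.
    - by apply/measurable_EFinP; exact: measurable_funTS.
    - by case/andP: c01 => /ltW.
  apply: (le_trans step); apply: lee_wpmul2l; first by rewrite lee_fin; case/andP: c01 => /ltW.
  pose D := C `&` [set x | 0 < k n x] `&` A n.
  have mD : measurable D by exact: measurableI.
  have kE : (I (w n) D <= I Z D)%E.
    apply: le_integral_EFin => //; [exact: measurable_funTS..|].
    by move=> x [_ /ZA ->]; rewrite lexx andbT; have /andP[] := w1 n x.
  rewrite kI//; apply: (le_trans kE).
  apply: subset_integral_EFin => //; first exact: measurable_funTS.
  by move=> x [[]].
- move=> C a mC a0 wa; rewrite QE EFinM -muleA muleC; apply: lee_wpmul2l.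
    by rewrite lee_fin ltW.
  rewrite -integral_cst//; apply: le_integral_EFin => //; first exact: measurable_funTS.
  move=> x /wa wxa; rewrite Z0/=; apply: le_trans wxa.
  by rewrite -w00; apply: ZE; rewrite E0.
Qed.
End RetiringMeasure.

(** * Geometric series estimates after a move *)

Section RetirementEstimates.
Context {R : realType} {disp : measure_display} {Omega : measurableType disp}.
Variables (Q : probability Omega R) (E : nat -> set Omega)
  (G : nat -> set (set Omega)) (rho c : R) (f : Omega -> R).
(* [cE] says that [1 + (c * rho) * rho = rho]: [rho] is the sum of the geometric
   series of ratio [c * rho]. *)
Hypotheses (rho1 : 1 < rho) (cE : c * rho ^+ 2 = rho - 1)
  (Gm : forall n, G n `<=` measurable) (mE : forall n, measurable (E n))
  (Efin : forall w, exists n, ~ E n w) (Edec : forall n, E n.+1 `<=` E n)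
  (Gnext : forall n C, G n C -> G n.+1 (C `&` E n.+1))
  (retire : forall n C, G n C -> C `<=` E n -> (Q (C `&` E n.+1) <= c%:E * Q C)%E)
  (mf : measurable_fun setT f) (f0 : forall w, 0 <= f w).
Local Notation I f B := (\int[Q]_(x in B) (f x)%:E)%E.

Let rho0 : 0 < rho. Proof. exact: lt_trans rho1. Qed.
Let c0 : 0 < c. Proof. by rewrite -(pmulr_lgt0 _ (exprn_gt0 2 rho0)) cE subr_gt0. Qed.

Lemma integral_le_cst C (b : R) : measurable C -> (forall w, C w -> f w <= b) ->
  (I f C <= b%:E * Q C)%E.
Proof.
move=> mC fb; rewrite -integral_cst//; apply: le_integral_EFin => //.
  exact: measurable_funTS.
by move=> w Cw; rewrite f0 fb.
Qed.

Lemma integral_ge_cst C (a : R) : measurable C -> 0 <= a -> (forall w, C w -> a <= f w) ->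
  (a%:E * Q C <= I f C)%E.
Proof.
move=> mC a0 fa; rewrite -integral_cst//; apply: le_integral_EFin => //.
  exact: measurable_funTS.
by move=> w Cw; rewrite a0 fa.
Qed.

Lemma integral_setDI C D : measurable C -> measurable D ->
  (I f C = I f (C `\` D) + I f (C `&` D))%E.
Proof.
move=> mC mD; rewrite -[in LHS](setUIDK C D) setUC ge0_integral_setU//.
- exact: measurableD.
- exact: measurableI.
- by apply: measurable_funTS; exact/measurable_EFinP.
- by move=> w _; rewrite lee_fin.
- by rewrite disj_set2E; apply/eqP/seteqP; split => // w [[_ nD] [_]].
Qed.

Lemma probability_setDI C D : measurable C -> measurable D ->
  (Q C = Q (C `\` D) + Q (C `&` D))%E.
Proof. by move=> mC mD; rewrite [LHS](measureDI Q mC mD). Qed.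

(** The truncation at [J] further moves makes an induction possible. Paths that retire at once
    contribute at most [b * Q C]; the others have [Q]-mass at most [c * Q C] and satisfy the
    hypothesis with [b * rho] for [b]. By [cE] the two parts add up to [b * rho * Q C]. *)
Lemma integral_before_le J n C (b : R) : G n C -> C `<=` E n -> 0 <= b ->
  (forall j w, C w -> ~ E (n + j).+1 w -> f w <= b * rho ^+ j) ->
  (I f (C `\` E (n + J)) <= (b * rho)%:E * Q C)%E.
Proof.
elim: J n C b => [|J IH] n C b GC CE b0 fb; have mC := Gm GC.
  rewrite addn0 (_ : C `\` E n = set0) ?integral_set0; last first.
    by apply/seteqP; split => // w [/CE].
  by rewrite mule_ge0// lee_fin mulr_ge0// ltW.
have b1 : 0 <= b * rho by rewrite mulr_ge0// ltW.
rewrite (@integral_setDI _ (E n.+1))//; last exact: measurableD.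
have le1 : (I f ((C `\` E (n + J.+1)) `\` E n.+1) <= b%:E * Q C)%E.
  apply: (@le_trans _ _ (b%:E * Q ((C `\` E (n + J.+1)) `\` E n.+1))%E).
    apply: integral_le_cst; first by apply: measurableD => //; exact: measurableD.
    by move=> w [[Cw _] nE]; have := fb 0%N w Cw; rewrite addn0 expr0 mulr1; apply.
  apply: lee_wpmul2l; first by rewrite lee_fin.
  apply: le_measure; rewrite ?inE//; first by apply: measurableD => //; exact: measurableD.
  by move=> w [[]].
have le2 : (I f ((C `\` E (n + J.+1)) `&` E n.+1) <= (b * rho * rho)%:E * (c%:E * Q C))%E.
  have -> : (C `\` E (n + J.+1)) `&` E n.+1 = (C `&` E n.+1) `\` E (n.+1 + J).
    by rewrite addSnnS; apply/seteqP; split => w [[]].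
  apply: (@le_trans _ _ ((b * rho * rho)%:E * Q (C `&` E n.+1))%E).
    apply: IH => //; [exact: Gnext| by move=> j w [Cw _]; rewrite addSnnS -mulrA -exprS; exact: fb].
  apply: lee_wpmul2l; first by rewrite lee_fin mulr_ge0// ltW.
  exact: retire.
apply: (le_trans (leeD le1 le2)).
have /fineK <- : Q C \is a fin_num by exact: fin_num_measure.
rewrite -!EFinM -EFinD lee_fin.
have -> : b * rho * rho * (c * fine (Q C)) = b * (c * rho ^+ 2) * fine (Q C) by ring.
by rewrite cE mulrBr mulr1 mulrBl addrC subrK.
Qed.

(** Every path retires, so monotone convergence removes the truncation. *)
Lemma integral_stopped_le n C (b : R) : G n C -> C `<=` E n -> 0 <= b ->
  (forall j w, C w -> ~ E (n + j).+1 w -> f w <= b * rho ^+ j) ->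
  (I f C <= (b * rho)%:E * Q C)%E.
Proof.
move=> GC CE b0 fb; have mC := Gm GC.
have CU : C = \bigcup_J (C `\` E (n + J)).
  apply/seteqP; split => [w Cw|w [J _ []]//].
  have [m nm] := Efin w; exists m => //; split => // Em; apply: nm.
  by elim: n Em {GC CE fb} => // k IHk /Edec.
rewrite [in leLHS]CU.
have mD J : measurable (C `\` E (n + J)) by exact: measurableD.
have ndD : nondecreasing_seq (fun J => C `\` E (n + J)).
  apply/nondecreasing_seqP => J; rewrite subsetEset => w [Cw nE]; split => //.
  by rewrite addnS => /Edec.
have cvg := @ge0_nondecreasing_set_cvg_integral _ _ _ _ (EFin \o f) Q ndD mD
  (fun J => measurable_funTS ((measurable_EFinP _ _).2 mf)) (fun J w _ => f0 w).
rewrite -(cvg_lim _ cvg)//; apply: lime_le; first by apply/cvg_ex; eexists; exact: cvg.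
by apply: nearW => J; exact: integral_before_le.
Qed.

(** The paths that retire at once suffice: their share is at least [1 - c], which is at least
    [1 / rho]. *)
Lemma integral_stopped_ge n C (a : R) : G n C -> C `<=` E n -> 0 <= a ->
  (forall w, C w -> ~ E n.+1 w -> a <= f w) ->
  ((a / rho)%:E * Q C <= I f C)%E.
Proof.
move=> GC CE a0 fa; have mC := Gm GC.
apply: (@le_trans _ _ (I f (C `\` E n.+1))); last first.
  apply: subset_integral_EFin => //; [exact: measurableD|exact: measurable_funTS].
apply: (@le_trans _ _ (a%:E * Q (C `\` E n.+1))%E); last first.
  by apply: integral_ge_cst => //; [exact: measurableD|move=> w []; exact: fa].
have := retire GC CE; have QD := probability_setDI mC (mE n.+1).
have fin B : measurable B -> Q B \is a fin_num by exact: fin_num_measure.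
move: QD; rewrite -(fineK (fin _ mC)) -(fineK (fin _ (measurableD mC (mE n.+1)))).
rewrite -(fineK (fin _ (measurableI _ _ mC (mE n.+1)))) => -[QD].
rewrite -!EFinM !lee_fin => Qc.
have q0 : 0 <= fine (Q C) by rewrite fine_ge0.
(* By [cE], [rho^2 * (1 - c) = rho^2 - rho + 1], which exceeds [rho] by [(rho - 1)^2]. *)
have ri : rho^-1 * fine (Q C) <= (1 - c) * fine (Q C).
  apply: ler_wpM2r => //; rewrite -(ler_pM2l rho0) divff ?gt_eqF//.
  rewrite -(ler_pM2l rho0) (_ : rho * (rho * _) = rho ^+ 2 - c * rho ^+ 2); last by ring.
  by rewrite cE expr2; have := sqr_ge0 (rho - 1); rewrite expr2; nra.
rewrite -mulrA; apply: ler_wpM2l => //; apply: (le_trans ri).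
rewrite QD; nra.
Qed.

End RetirementEstimates.

(** * Adaptedness of moves and measurability of the oscillation *)

Section StickyProcess.
Context {R : realType} {disp : measure_display} {Omega : measurableType disp}.
Variables (P : probability Omega R) (T : R) (F : R -> set (set Omega)) (d : nat)
  (S : 'I_d -> R -> Omega -> R).
Hypotheses (T0 : 0 < T) (uF : usual_filtration P T F) (aS : adapted T F S)
  (cS : forall i w, {within `[0, T], continuous (fun t => S i t w)})
  (S0 : forall i t w, t \in `[0, T] -> 0 < S i t w).

Local Notation X w := (fun i t => S i t w).

Lemma filtration_sigma_algebra t : 0 <= t <= T -> sigma_algebra setT (F t).
Proof. by case: uF => h _ _ _ _ tT; have [] := h t; rewrite ?in_itv. Qed.

Lemma filtration_measurable t : 0 <= t <= T -> F t `<=` measurable.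
Proof. by case: uF => h _ _ _ _ tT; have [] := h t; rewrite ?in_itv. Qed.

Lemma filtration_le s t : 0 <= s -> s <= t -> t <= T -> F s `<=` F t.
Proof. by case: uF => _ h _ _ _ s0 st tT; apply: h => //; rewrite in_itv /=; lra. Qed.

Lemma filtration_end : F T = measurable.
Proof. by case: uF. Qed.

Lemma adapted_measurable i s t : 0 <= s -> s <= t -> t <= T ->
  measurable_fun setT (S i s : g_sigma_algebraType (F t) -> R).
Proof.
move=> s0 st tT; apply/measurable_wrtP; first by apply: filtration_sigma_algebra; lra.
move=> B mB; apply: (filtration_le s0 st tT); apply: aS => //.
by rewrite in_itv /=; lra.
Qed.

Lemma process_measurable i t : 0 <= t <= T -> measurable_fun setT (S i t).
Proof.
move=> tT _ B mB; rewrite setTI; apply: (filtration_measurable tT); exact: aS.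
Qed.

Lemma path_pos w i t : 0 <= t <= T -> 0 < X w i t.
Proof. by move=> tT; apply: S0; rewrite in_itv. Qed.

Lemma path_cont w i : {within `[0, T], continuous (X w i)}.
Proof. exact: cS. Qed.

Lemma filtration_moved (r : R) (E : R -> set Omega) t : 0 < r -> 0 <= t <= T ->
  (forall w, path_open T (fun u => E u w)) -> (forall u, 0 <= u <= T -> F u (E u)) ->
  F t [set w | moved r (X w) (fun u => E u w) t].
Proof.
move=> r0 tT oE FE.
have t0 : 0 <= t by lra.
have sFt := filtration_sigma_algebra tT.
have FEc q : F t (E (clamp t (ratr q))).
  have := @clamp_itv _ t (ratr q) t0 => cq.
  by apply: (@filtration_le (clamp t (ratr q)) t); try lra; apply: FE; lra.
rewrite (_ : [set w | _] = \bigcup_(z : rat * rat * 'I_d)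
    (E (clamp t (ratr z.1.1)) `&` (E (clamp t (ratr z.1.2)) `&`
      [set w | r * S z.2 (clamp t (ratr z.1.2)) w < S z.2 (clamp t (ratr z.1.1)) w]))).
  apply: sub_sigma_algebra_bigcup => // -[[p q] i] /=.
  have cp := @clamp_itv _ t (ratr p) t0; have cq := @clamp_itv _ t (ratr q) t0.
  do 2 apply: sub_sigma_algebraI => //.
  rewrite -(measurable_g_measurableTypeE sFt).
  apply: (@measurable_lt _ _ (g_sigma_algebraType (F t))).
    by apply: measurable_funM => //; apply: adapted_measurable; lra.
  by apply: adapted_measurable; lra.
apply/seteqP; split => w /=.
  move=> /(moved_ratP (@path_cont w) r0 (oE w) tT) [p [q [i [Ep Eq h]]]].
  by exists (p, q, i).
move=> [[[p q] i] _ /= [Ep [Eq h]]].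
by apply/(moved_ratP (@path_cont w) r0 (oE w) tT); exists p, q, i.
Qed.

Lemma filtration_reach (r : R) n t : 0 < r -> 0 <= t <= T ->
  F t [set w | reach r (X w) n t].
Proof.
move=> r0; elim: n t => [|n IH] t tT /=.
  rewrite (_ : [set _ | True] = ~` set0); last by rewrite setC0.
  by apply: sub_sigma_algebraC; have := filtration_sigma_algebra tT; case.
apply: filtration_moved => // w.
exact: (path_open_reach (@path_cont w)).
Qed.

Lemma Sstar_ub w t u i : 0 <= t <= T -> t <= u <= T ->
  `|S i u w - S i t w| <= Sstar T S t w.
Proof.
move=> tT uT.
have H j : exists b, forall v, t <= v <= T -> `|S j v w - S j t w| <= b.
  (* The set under [sup] must be shown bounded. Both values lie between [0] and the maximum of the
     path, hence so does the size of their difference. *)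
  have [m _ hm] := EVT_max (ltW T0) (@path_cont w j).
  exists (S j m w) => v vT.
  have sv : 0 < S j v w by apply: path_pos; lra.
  have st : 0 < S j t w by apply: path_pos; lra.
  have mv : S j v w <= S j m w by apply: hm; rewrite in_itv /=; lra.
  have mt : S j t w <= S j m w by apply: hm; rewrite in_itv /=; lra.
  by rewrite ler_norml; lra.
have [b bP] := choice H.
apply: (@le_trans _ _ (maxnorm (fun j => S j u w - S j t w))).
  exact: (le_bigmax _ (fun j => `|S j u w - S j t w|)).
apply: ub_le_sup; last by exists u => //=; rewrite in_itv.
exists (\big[Num.max/0]_j b j) => _ [v /= vT <-]; rewrite in_itv /= in vT.
apply: bigmax_le => [|j _]; first exact: bigmax_ge_id.
by apply: (le_trans (bP j v vT)); exact: (le_bigmax _ b).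
Qed.

(** The margin [k.+1%:R^-1] turns the strict bound on a supremum into weak bounds that pass from
    rational to all times by continuity. The condition [0 <= delta - k.+1%:R^-1] serves the base
    value [0] in [maxnorm]. *)
Lemma Sstar_ltP w t (delta : R) : 0 <= t <= T -> 0 < delta ->
  Sstar T S t w < delta <-> exists k : nat, 0 <= delta - k.+1%:R^-1 /\
    forall (q : rat) i,
      `|S i (t + clamp (T - t) (ratr q)) w - S i t w| <= delta - k.+1%:R^-1.
Proof.
move=> tT d0; have Tt : 0 <= T - t by lra.
split=> [sd|[k [k0 hk]]].
  have : Num.max 0 (Sstar T S t w) < delta by rewrite gt_max d0.
  move=> /ltr_add_invr[k]; set s := Num.max _ _ => sk.
  have s0 : 0 <= s by rewrite le_max lexx.
  exists k; split; first by rewrite subr_ge0 (le_trans _ (ltW sk))// lerDr.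
  move=> q i; have := @clamp_itv _ _ (ratr q) Tt => cq.
  apply: (@le_trans _ _ s); last by rewrite lerBrDr ltW.
  by rewrite le_max Sstar_ub ?orbT//; lra.
have : 0 < k.+1%:R^-1 :> R by rewrite invr_gt0.
move: (k.+1%:R^-1 : R) k0 hk => c k0 hk c0.
apply: (@le_lt_trans _ _ (delta - c)); last by rewrite gtrBl.
apply: ge_sup; first by exists (maxnorm (fun i => S i t w - S i t w)), t => //=; rewrite in_itv /=; lra.
move=> _ [u /= + <-]; rewrite in_itv /= => uT; apply: bigmax_le => // i _.
rewrite leNgt; apply/negP => lt.
have uT' : 0 <= u <= T by lra.
pose e := `|S i u w - S i t w| - (delta - c).
have e0 : 0 < e by rewrite /e; lra.
have [eta eta0 he] := path_continuous (@path_cont w) i uT' e0.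
have uTt : 0 <= u - t <= T - t by lra.
have [q qu] := clamp_dense uTt eta0.
have cq := @clamp_itv _ _ (ratr q) Tt.
have := he (t + clamp (T - t) (ratr q)); rewrite (_ : _ - u = clamp (T - t) (ratr q) - (u - t)); last by ring.
move=> /(_ ltac:(lra) qu); have := hk q i; set a := S i (_ + _) w; rewrite /e.
move=> h1 h2.
have := ler_normD (S i u w - a) (a - S i t w); rewrite (distrC _ a) addrA subrK; lra.
Qed.

Lemma measurable_Sstar_lt t (delta : R) : 0 <= t <= T -> 0 < delta ->
  measurable [set w | Sstar T S t w < delta].
Proof.
move=> tT d0; have Tt : 0 <= T - t by lra.
rewrite (_ : [set w | _] = \bigcup_(k in [set k : nat | 0 <= delta - k.+1%:R^-1])
   ~` \bigcup_(z : rat * 'I_d) [set w | delta - k.+1%:R^-1 <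
     `|S z.2 (t + clamp (T - t) (ratr z.1)) w - S z.2 t w|]).
  apply: bigcup_measurable => k _; apply: measurableC.
  apply: countable_bigcupT_measurable => // -[q i] /=.
  apply: measurable_lt => //; apply: measurableT_comp => //.
  have cq := @clamp_itv _ _ (ratr q) Tt.
  by apply: measurable_funB; apply: process_measurable; lra.
apply/seteqP; split => w /=.
  move=> /(Sstar_ltP _ tT d0)[k [k0 hk]]; exists k => //= -[[q i] _ /=].
  by rewrite ltNge hk.
move=> [k /= k0 hk]; apply/(Sstar_ltP _ tT d0); exists k; split => // q i.
by rewrite leNgt; apply/negP => h; apply: hk; exists (q, i).
Qed.

(* With [E t] the event that a move happens before [t], this is the sigma-algebra
   of the events known right after that move. *)
Definition stopped (E : R -> set Omega) : set (set Omega) :=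
  [set A | measurable A /\ forall t, 0 <= t <= T -> F t (A `&` E t)].

Lemma stopped_sigma_algebra (E : R -> set Omega) :
  (forall t, 0 <= t <= T -> F t (E t)) -> sigma_algebra setT (stopped E).
Proof.
move=> FE; split.
- split=> // t tT; rewrite set0I.
  by have [] := filtration_sigma_algebra tT.
- move=> A [mA FA]; split; first by rewrite setTD; exact: measurableC.
  move=> t tT; have sF := filtration_sigma_algebra tT.
  rewrite (_ : _ `&` _ = E t `&` ~` (A `&` E t)).
    apply: sub_sigma_algebraI => //; first exact: FE.
    by apply: sub_sigma_algebraC => //; exact: FA.
  apply/seteqP; split => x /=; first by move=> [[_ nA] Ex]; split => // -[].
  by move=> [Ex nAE]; split => //; split => // Ax; apply: nAE.
- move=> A FA; split; first by apply: bigcupT_measurable => k; have [] := FA k.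
  move=> t tT; have sF := filtration_sigma_algebra tT.
  rewrite setI_bigcupl; apply: sub_sigma_algebra_bigcup => // k.
  by have [_] := FA k; apply.
Qed.

Local Notation reached rho n t := [set w | reach rho (X w) n t].

(** * From stickiness at fixed times to retiring after a move *)

Section Reach.
Variable rho : R.
Hypothesis rho1 : 1 < rho.
Let rho0 : 0 < rho. Proof. exact: lt_trans rho1. Qed.

Lemma measurable_reached n : measurable (reached rho n T).
Proof. by rewrite -filtration_end; apply: filtration_reach; rewrite // lexx ltW. Qed.

Local Notation G n := (stopped (fun t => reached rho n t)).

Lemma stopped_reached n : G n (reached rho n T).
Proof.
split; first exact: measurable_reached.
move=> t tT; rewrite setIidr; first exact: filtration_reach.
by move=> w; apply: reach_le; lra.
Qed.

Lemma stopped_next n C : G n C -> G n.+1 (C `&` reached rho n.+1 T).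
Proof.
move=> [mC FC]; split; first by apply: measurableI => //; exact: measurable_reached.
move=> t tT; rewrite [Y in F t Y](_ : _ = (C `&` reached rho n t) `&` reached rho n.+1 t).
  apply: (sub_sigma_algebraI (filtration_sigma_algebra tT) (FC t tT)).
  exact: filtration_reach.
apply/seteqP; split => w; first by move=> [[Cw _] rw]; split => //; split => //; exact: reachS.
move=> [[Cw _] rw]; split => //; split => //.
by apply: (@reach_le _ _ rho _ n.+1 t T) => //; lra.
Qed.

(** What is known at [t] is still known at any move that comes later. This carries events of [F t]
    to the next move, where [retire] applies. *)
Lemma stopped_after n t C : 0 <= t <= T -> F t C ->
  (forall w, C w -> ~ reach rho (X w) n t) -> G n (C `&` reached rho n T).
Proof.
move=> tT FC nr; split.
  by apply: measurableI; [exact: (filtration_measurable tT)|exact: measurable_reached].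
move=> s sT; have sF := filtration_sigma_algebra sT.
have [st|ts] := leP s t.
  rewrite [Y in F s Y](_ : _ = set0); first by case: sF.
  by apply/seteqP; split => w // [[/nr nw _] rs]; apply: nw; exact: reach_le st rs.
rewrite [Y in F s Y](_ : _ = C `&` reached rho n s).
  apply: sub_sigma_algebraI => //; last exact: filtration_reach.
  by apply: (@filtration_le t s) => //; lra.
apply/seteqP; split => w; first by move=> [[Cw _] rw].
move=> [Cw rw]; split => //; split => //.
by apply: (@reach_le _ _ rho _ n s T) => //; lra.
Qed.

Hypothesis stS : sticky P T F S.

(** This is [stuck]. Countably many events [C q k] cover [B]: at the rational time the [n]-th move
    is past, the oscillation since then is at most [sqrt rho], and all coordinates are at least
    [k.+1%:R^-1]. If [Sstar] is small from then on, the path retires, which has probability zero on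
    [B]; stickiness then makes each [C q k] null. *)
Lemma retire_pos n B : G n B -> B `<=` reached rho n T ->
  P (B `\` reached rho n.+1 T) = 0%E -> P B = 0%E.
Proof.
move=> GB BR PB; have [mB FB] := GB.
pose r1 := Num.sqrt rho.
have r11 : 1 < r1 by rewrite /r1 -[ltLHS]sqrtr1 ltr_sqrt.
have r1E : r1 * r1 = rho by rewrite -expr2 sqr_sqrtr// ltW.
have r10 : 0 < r1 by lra.
pose C (q : rat) (k : nat) := if clamp T (ratr q) < T then
  (B `&` reached rho n (clamp T (ratr q))) `&`
  (~` [set w | moved r1 (X w) (reach rho (X w) n) (clamp T (ratr q))] `&`
   ~` \bigcup_i [set w | S i (clamp T (ratr q)) w < k.+1%:R^-1]) else set0.
have Cnull q k : P.-negligible (C q k).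
  rewrite /C; set t := clamp _ _; case: ifPn => [tT|_]; last exact: negligible_set0.
  have /andP[t0 _] := @clamp_itv _ T (ratr q) (ltW T0); rewrite -/t in t0.
  have tT' : 0 <= t <= T by lra.
  set C' := (X in P.-negligible X).
  have sF := filtration_sigma_algebra tT'.
  have FC : F t C'.
    apply: sub_sigma_algebraI => //; first exact: FB.
    apply: sub_sigma_algebraI => //; apply: sub_sigma_algebraC => //.
      apply: (filtration_moved (E := fun u => reached rho n u)) => //.
        by move=> w; exact: (path_open_reach (@path_cont w)).
      by move=> u uT; exact: filtration_reach.
    apply: sub_sigma_algebra_bigcup => // i.
    rewrite (_ : [set w | _] = S i t @^-1` `]-oo, k.+1%:R^-1[).
      by apply: aS => //; rewrite in_itv.
    by apply/seteqP; split => w /=; rewrite in_itv.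
  pose c : R := k.+1%:R^-1.
  have c0 : 0 < c by rewrite invr_gt0.
  (* For a coordinate that is at least [c], a drop by [delta] still loses at most a factor [r1]; a
     rise by [delta] is less critical. *)
  pose delta := (r1 - 1) * c / r1.
  have delta0 : 0 < delta by rewrite divr_gt0// mulr_gt0// subr_gt0.
  have deltaE : r1 * delta = (r1 - 1) * c by rewrite /delta mulrC divfK ?gt_eqF.
  have [|Y [[mY iY YE] Ypos]] := stS (t := t) _ delta0; first by rewrite in_itv /= t0.
  have FY : F t [set w | 0 < Y w].
    rewrite (_ : [set w | _] = Y @^-1` `]0, +oo[); first exact: mY.
    by apply/seteqP; split => w /=; rewrite in_itv/= andbT.
  (* [Y] is positive only almost surely; on this event it is so everywhere, and its vanishing
     integral forces the event to be null. *)
  have FCY : F t (C' `&` [set w | 0 < Y w]) by exact: sub_sigma_algebraI.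
  have mCY := filtration_measurable tT' FCY.
  have mA := measurable_Sstar_lt tT' delta0.
  have PA0 : P ([set w | Sstar T S t w < delta] `&` (C' `&` [set w | 0 < Y w])) = 0%E.
    apply: (@subset_measure0 _ _ _ P _ (B `\` reached rho n.+1 T)) => //.
    - exact: measurableI.
    - by apply: measurableD => //; exact: measurable_reached.
    move=> w [/= Aw [[[Bw rt] [nm nc]] _]]; split => // -[u [v [i [uT vT ru rv]]]].
    have cS' j : c <= S j t w.
      by rewrite leNgt; apply/negP => h; apply: nc; exists j.
    have near_t j s : 0 <= s <= T -> reach rho (X w) n s ->
        S j s w <= r1 * S j t w /\ S j t w <= r1 * S j s w.
      move=> sT rs; have [st|ts] := leP s t.
        by split; apply: (not_moved nm) => //; lra.
      have ts' : t <= s <= T by lra.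
      have := le_lt_trans (@Sstar_ub w t s j tT' ts') Aw; rewrite ltr_norml => /andP[h1 h2].
      have := cS' j; split; nra.
    have [h1 _] := near_t i u uT ru; have [_ h2] := near_t i v vT rv.
    by apply/negP; rewrite -leNgt (le_trans h1)// -r1E -mulrA ler_pM2l.
  have Y0 : P.-negligible (C' `&` [set w | 0 < Y w] `&` [set w | 0 < Y w]).
    apply: integral_eq0_pos => //; last by rewrite YE.
    - by apply: measurable_funTS; apply/measurable_EFinP; exact: measurable_int iY.
    - by move=> w [_ /= /ltW].
  apply: negligibleS (negligibleU Y0 Ypos) => w Cw.
  by have [Yw|Yw] := pselect (0 < Y w); [left|right].
apply/negligibleP => //.
pose D m := if unpickle m is Some (q, k) then C q k else set0.
have Dnull m : P.-negligible (D m).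
  by rewrite /D; case: unpickle => [[q k]|]; [exact: Cnull|exact: negligible_set0].
apply: negligibleS (negligible_bigcup Dnull) => w Bw.
have [q [/andP[q0 qT] rq nq]] := reach_quiet (@path_cont w) (@path_pos w) r11 rho0 T0 (BR w Bw).
have qT' : 0 <= clamp T (ratr q) <= T by lra.
have [k hk] : exists k : nat, forall i, k.+1%:R^-1 <= S i (clamp T (ratr q)) w.
  have b0 : 0 < \big[Num.min/1]_i S i (clamp T (ratr q)) w.
    by apply: lt_bigmin => // i _; exact: path_pos.
  have [k] := ltr_add_invr b0; rewrite add0r => hk.
  exists k => i; apply: (le_trans (ltW hk)); exact: bigmin_le.
have [m Dm] : exists m, D m = C q k by exists (pickle (q, k)); rewrite /D pickleK.
exists m; first by [].
rewrite Dm /C qT; split; first by split.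
by split => // -[i _ /=]; rewrite ltNge hk.
Qed.

Local Notation c := ((rho - 1) / rho ^+ 2).

(** * Bounds on the conditional expectation of the final price *)

Section RetiringPrice.
Variables (Q : probability Omega R) (i : 'I_d).
Hypothesis retire : forall n C, G n C -> C `<=` reached rho n T ->
  (Q (C `&` reached rho n.+1 T) <= c%:E * Q C)%E.
Local Notation I f B := (\int[Q]_(x in B) (f x)%:E)%E.

Let cE : c * rho ^+ 2 = rho - 1.
Proof. by rewrite divfK// gt_eqF// exprn_gt0. Qed.

Let Tend : 0 <= T <= T. Proof. by rewrite lexx ltW. Qed.

Let mST : measurable_fun setT (S i T). Proof. exact: process_measurable. Qed.

Let ST0 w : 0 <= S i T w. Proof. exact/ltW/path_pos. Qed.

Let reached_fin w : exists n, ~ reached rho n T w.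
Proof. exact: (reach_finite (@path_cont w) (@path_pos w) rho1 (ltW T0)). Qed.

Let Gm n : G n `<=` measurable. Proof. by move=> A []. Qed.

Let reachedS n : reached rho n.+1 T `<=` reached rho n T.
Proof. by move=> w; exact: reachS. Qed.

Lemma end_close n j t w : 0 <= t <= T -> reach rho (X w) n t ->
  ~ reach rho (X w) n.+1 t -> ~ reach rho (X w) (n + j).+1 T ->
  S i t w <= rho ^+ j.+1 * S i T w /\ S i T w <= rho ^+ j.+1 * S i t w.
Proof.
move=> tT rt nr nT.
apply: (reach_close (@path_cont w) (@path_pos w) i rho1 tT _ nr nT).
by move=> u /andP[tu _]; apply: reach_le rt; exact: ltW.
Qed.

(** [retire] controls the chance of moving on only right after a move, while [t] lies between moves.
    Hence the split: without a further move [S_T] is at most [rho * b]; otherwise the series starts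
    at move [n.+1] with constant [rho^2 * b], as [j] moves after that one allow a factor
    [rho^(j+2)], and its sum costs the third [rho]. *)
Lemma piece_le n t C (b : R) : 0 <= t <= T -> F t C ->
  (forall w, C w -> reach rho (X w) n t /\ ~ reach rho (X w) n.+1 t) ->
  0 <= b -> (forall w, C w -> S i t w <= b) ->
  (I (S i T) C <= (rho ^+ 3 * b)%:E * Q C)%E.
Proof.
move=> tT FC Cn b0 Sb; have mC := filtration_measurable tT FC.
have mE := measurable_reached.
rewrite (integral_setDI Q mST ST0 mC (mE n.+1)).
have le1 : (I (S i T) (C `\` reached rho n.+1 T) <=
    (rho * b)%:E * Q (C `\` reached rho n.+1 T))%E.
  apply: integral_le_cst => //; first exact: measurableD.
  move=> w [Cw nT]; have [rt nrt] := Cn w Cw.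
  have [] := end_close (j := 0) tT rt nrt; first by rewrite addn0.
  rewrite expr1 => _ h; apply: (le_trans h); rewrite ler_pM2l//; exact: Sb.
have le2 : (I (S i T) (C `&` reached rho n.+1 T) <=
    (rho ^+ 2 * b * rho)%:E * Q (C `&` reached rho n.+1 T))%E.
  apply: (integral_stopped_le rho1 cE Gm mE reached_fin reachedS stopped_next retire) => //.
  - by apply: (stopped_after tT FC) => w /Cn[].
  - by rewrite mulr_ge0// exprn_ge0// ltW.
  move=> j w [Cw _] nT; have [rt nrt] := Cn w Cw.
  have [|_ h] := end_close (j := j.+1) tT rt nrt; first by rewrite -addSnnS.
  apply: (le_trans h); rewrite -mulrA [b * _]mulrC mulrA -exprD add2n.
  by rewrite ler_pM2l ?exprn_gt0//; exact: Sb.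
apply: (le_trans (leeD le1 le2)).
rewrite [in leRHS](probability_setDI Q mC (mE n.+1)).
have fin B : measurable B -> Q B \is a fin_num by exact: fin_num_measure.
rewrite -(fineK (fin _ (measurableD mC (mE n.+1)))).
rewrite -(fineK (fin _ (measurableI _ _ mC (mE n.+1)))).
set p := fine _; set q := fine _.
have p0 : 0 <= p by exact: fine_ge0.
rewrite -!EFinM -!EFinD lee_fin.
have -> : rho ^+ 3 * b * (p + q) = rho * b * p * rho ^+ 2 + rho ^+ 2 * b * rho * q by ring.
rewrite lerD2r ler_peMr//; last by rewrite expr_ge1 ?ltW.
by rewrite !mulr_ge0// ltW.
Qed.

(** The same split. If a move follows, retiring right after it leaves [S_T >= a / rho^2], and the
    share of those paths costs another [rho]. *)
Lemma piece_ge n t C (a : R) : 0 <= t <= T -> F t C ->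
  (forall w, C w -> reach rho (X w) n t /\ ~ reach rho (X w) n.+1 t) ->
  0 <= a -> (forall w, C w -> a <= S i t w) ->
  ((a / rho ^+ 3)%:E * Q C <= I (S i T) C)%E.
Proof.
move=> tT FC Cn a0 Sa; have mC := filtration_measurable tT FC.
have mE := measurable_reached.
rewrite (integral_setDI Q mST ST0 mC (mE n.+1)).
have le1 : ((a / rho)%:E * Q (C `\` reached rho n.+1 T) <=
    I (S i T) (C `\` reached rho n.+1 T))%E.
  apply: integral_ge_cst => //; first exact: measurableD.
    by rewrite divr_ge0// ltW.
  move=> w [Cw nT]; have [rt nrt] := Cn w Cw.
  have [] := end_close (j := 0) tT rt nrt; first by rewrite addn0.
  rewrite expr1 => h _; rewrite ler_pdivrMr// mulrC; apply: le_trans h; exact: Sa.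
have le2 : ((a / rho ^+ 2 / rho)%:E * Q (C `&` reached rho n.+1 T) <=
    I (S i T) (C `&` reached rho n.+1 T))%E.
  apply: (integral_stopped_ge rho1 cE Gm mE retire mST ST0 (n := n.+1)) => //.
  - by apply: (stopped_after tT FC) => w /Cn[].
  - by rewrite divr_ge0// exprn_ge0// ltW.
  move=> w [Cw _] nT; have [rt nrt] := Cn w Cw.
  have [|h _] := end_close (j := 1) tT rt nrt; first by rewrite addn1.
  by rewrite ler_pdivrMr ?exprn_gt0// mulrC; apply: le_trans h; exact: Sa.
apply: le_trans (leeD le1 le2).
rewrite [in leLHS](probability_setDI Q mC (mE n.+1)).
have fin B : measurable B -> Q B \is a fin_num by exact: fin_num_measure.
rewrite -(fineK (fin _ (measurableD mC (mE n.+1)))).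
rewrite -(fineK (fin _ (measurableI _ _ mC (mE n.+1)))).
set p := fine _; set q := fine _.
have p0 : 0 <= p by exact: fine_ge0.
rewrite -!EFinM -!EFinD lee_fin.
have r0 : rho != 0 by rewrite gt_eqF.
have -> : a / rho * p + a / rho ^+ 2 / rho * q =
    a / rho ^+ 3 * (p * rho ^+ 2 + q) by field.
rewrite ler_wpM2l//; first by rewrite divr_ge0// exprn_ge0// ltW.
by rewrite lerD2r ler_peMr// expr_ge1 ?ltW.
Qed.

(** Split by the integer part [j] of the initial price. On that event the integral of [S_T] is at
    most [rho^3 * (j+1)] times its [Q]-mass, which is at most [H / (j+1)] times its [P]-mass; the
    factors [j+1] cancel and the sum is at most [rho^3 * H]. *)
Lemma integrable_end (H : R) :
  (forall C a, measurable C -> 0 <= a ->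
    (forall w, C w -> (1 + \sum_j S j 0 w)^-1 <= a) -> (Q C <= (H * a)%:E * P C)%E) ->
  Q.-integrable setT (EFin \o S i T).
Proof.
move=> QP.
have T00 : 0 <= (0 : R) <= T by rewrite lexx ltW.
have S00 j w : 0 < S j 0 w by exact: path_pos.
pose C j := [set w | Num.trunc (S i 0 w) = j].
have CE j : C j = S i 0 @^-1` `[j%:R, j.+1%:R[.
  apply/seteqP; split => w /=; rewrite in_itv /= => Cw.
    by rewrite -Cw truncn_itv// ltW.
  exact: truncn_def.
have FC j : F 0 (C j) by rewrite CE; apply: aS => //; rewrite in_itv.
have mC j : measurable (C j) := filtration_measurable T00 (FC j).
have tC : trivIset setT C by exact: trivIset_preimage1.
have CT : \bigcup_j C j = setT.
  by apply/seteqP; split => // w _; exists (Num.trunc (S i 0 w)).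
have le j : (I (S i T) (C j) <= (rho ^+ 3 * H)%:E * P (C j))%E.
  have j0 : 0 <= j.+1%:R :> R by [].
  apply: (@le_trans _ _ ((rho ^+ 3 * j.+1%:R)%:E * Q (C j))%E).
    apply: (piece_le T00 (FC j) (n := 0%N)) => // w.
      move=> _; split => // -[u [v [l [u0 v0 _ _]]]].
      have -> : u = 0 by lra.
      have -> : v = 0 by lra.
      by apply/negP; rewrite -leNgt /= ler_peMl ?ltW.
    by rewrite CE /= in_itv /= => /andP[_ /ltW].
  apply: (@le_trans _ _ ((rho ^+ 3 * j.+1%:R)%:E * ((H * j.+1%:R^-1)%:E * P (C j)))%E).
    apply: lee_wpmul2l; first by rewrite lee_fin mulr_ge0// exprn_ge0// ltW.
    apply: QP => // w; rewrite CE /= in_itv /= => /andP[jS _].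
    rewrite lef_pV2 ?posrE//; last first.
      by rewrite ltr_pwDl// sumr_ge0// => l _; exact: ltW.
    rewrite -natr1 addrC lerD2l (bigD1 i)//= (le_trans jS)// lerDl sumr_ge0// => l _.
    exact: ltW.
  by rewrite muleA -EFinM mulrACA divff// mulr1.
apply/integrableP; split; first exact/measurable_EFinP.
apply: (@le_lt_trans _ _ ((rho ^+ 3 * H)%:E * P setT)%E); last first.
  by rewrite probability_setT mule1 ltry.
under eq_integral do rewrite /= ger0_norm//.
rewrite -CT ge0_integral_bigcup//; last 2 first.
- by apply: measurable_funTS; exact/measurable_EFinP.
- by move=> w _; rewrite lee_fin.
rewrite measure_semi_bigcup//; last by rewrite CT.
rewrite -nneseriesZl//.
by apply: lee_nneseries => // j _ _; apply: integral_ge0 => w _; rewrite lee_fin.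
Qed.

Let piece n t (a : R) := [set w | [/\ reach rho (X w) n t,
  ~ reach rho (X w) n.+1 t & a <= S i t w < rho * a]].

Lemma filtration_piece n t (a : R) : 0 <= t <= T -> F t (piece n t a).
Proof.
move=> tT; have sF := filtration_sigma_algebra tT.
rewrite (_ : piece n t a = reached rho n t `&` ~` reached rho n.+1 t `&`
    S i t @^-1` `[a, rho * a[).
  apply: sub_sigma_algebraI => //; last by apply: aS => //; rewrite in_itv.
  apply: sub_sigma_algebraI => //; first exact: filtration_reach.
  by apply: sub_sigma_algebraC => //; exact: filtration_reach.
apply/seteqP; split => w /=; rewrite in_itv /=; first by case.
by move=> [[]].
Qed.

(** Countably many pieces cover the space: [a] can be any rational between [S_t / rho] and [S_t]. *)
Lemma negligible_pieces t U : 0 <= t <= T ->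
  (forall n a, 0 < a -> Q.-negligible (U `&` piece n t a)) -> Q.-negligible U.
Proof.
move=> tT h.
pose D m := if unpickle m is Some (q, n) then
  if 0 < ratr q :> R then U `&` piece n t (ratr q) else set0 else set0.
have Dnull m : Q.-negligible (D m).
  rewrite /D; case: unpickle => [[q n]|]; last exact: negligible_set0.
  by case: ifPn => q0; [exact: h|exact: negligible_set0].
apply: negligibleS (negligible_bigcup Dnull) => w Uw.
have St := path_pos w i tT.
have /rat_in_itvoo[q] : S i t w / rho < S i t w by rewrite ltr_pdivrMr// ltr_pMr.
rewrite in_itv /= => /andP[q1 q2].
have q0 : 0 < ratr q :> R by apply: lt_trans q1; rewrite divr_gt0.
(* Descend from a stage not reached by [T]; stage [0] is always reached. *)
have [n [rn nrn]] : exists n, reach rho (X w) n t /\ ~ reach rho (X w) n.+1 t.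
  have [n] := reached_fin w; elim: n => [[]//|n IH nT].
  have [rn|nrn] := pselect (reach rho (X w) n t); last first.
    elim: n nrn {IH nT} => [[]//|n IH nrn].
    by have [rn|] := pselect (reach rho (X w) n t); [exists n|exact: IH].
  exists n; split => // r; apply: nT; apply: reach_le r; lra.
have [m Dm] : exists m, D m = if 0 < ratr q :> R then U `&` piece n t (ratr q) else set0.
  by exists (pickle (q, n)); rewrite /D pickleK.
exists m; first by [].
rewrite Dm q0; split => //; split => //.
by rewrite (ltW q2)/= mulrC -ltr_pdivrMr.
Qed.

(** Let [C] be the part of a piece on which the upper bound fails. Then [(1 + eps) * a * Q C] is at
    most the integral of [M], that is of [S_T], hence at most [rho^4 * a * Q C], which forces
    [Q C = 0]. The lower bound is symmetric. *)
Lemma price_bounds (eps : R) t M : 0 < eps -> rho ^+ 4 < 1 + eps -> 0 <= t <= T ->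
  measurable_wrt (F t) M -> Q.-integrable setT (EFin \o M) ->
  (forall B, F t B -> I M B = I (S i T) B) ->
  Q.-negligible (~` [set w | S i t w / (1 + eps) <= M w <= (1 + eps) * S i t w]).
Proof.
move=> eps0 rhoe tT FM iM ME.
have e0 : 0 < 1 + eps by lra.
have sF := filtration_sigma_algebra tT.
have mM : measurable_fun setT (M : g_sigma_algebraType (F t) -> R).
  exact/measurable_wrtP.
have mSt : measurable_fun setT (S i t : g_sigma_algebraType (F t) -> R).
  by apply: adapted_measurable; lra.
have rho3 : 0 < rho ^+ 3 by rewrite exprn_gt0.
have Qfin C : measurable C -> (0 <= fine (Q C)) /\ Q C = (fine (Q C))%:E.
  by move=> mC; rewrite fine_ge0// fineK// fin_num_measure.
have nullC C : F t C -> fine (Q C) <= 0 -> Q.-negligible C.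
  move=> FC QC; have mC := filtration_measurable tT FC.
  have [Q0 QE] := Qfin C mC; apply: (negligibleP Q mC).2.
  by rewrite [LHS]QE; congr EFin; lra.
have ic C (k : R) : measurable C -> Q.-integrable C (EFin \o cst k).
  by move=> mC; exact: finite_measure_integrable_cst.
have up : Q.-negligible [set w | (1 + eps) * S i t w < M w].
  apply: (negligible_pieces tT) => n a a0; set C := _ `&` _.
  have FC : F t C.
    apply: sub_sigma_algebraI => //; last exact: filtration_piece.
    rewrite -(measurable_g_measurableTypeE sF).
    apply: (@measurable_lt _ _ (g_sigma_algebraType (F t))) => //.
    exact: measurable_funM.
  have mC := filtration_measurable tT FC.
  apply: nullC => //; have [Q0 QE] := Qfin C mC.
  have : (I (S i T) C <= (rho ^+ 3 * (rho * a))%:E * Q C)%E.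
    apply: (piece_le tT FC (n := n)).
    - by move=> w [_ []].
    - by rewrite mulr_ge0// ltW.
    - by move=> w [_ [_ _ /andP[_ /ltW]]].
  have : (((1 + eps) * a)%:E * Q C <= I M C)%E.
    rewrite -integral_cst//; apply: le_integral => //; first exact: ic.
      exact: integrableS iM.
    move=> w /[!inE] -[/= Mw [_ _ /andP[aSt _]]]; rewrite lee_fin.
    by apply: le_trans (ltW Mw); rewrite ler_pM2l.
  rewrite ME// => /le_trans h /h {h}; rewrite QE -!EFinM lee_fin mulrA -exprSr => h.
  have : a * ((1 + eps - rho ^+ 4) * fine (Q C)) <= 0 by nra.
  by rewrite pmulr_rle0// pmulr_rle0// subr_gt0.
have down : Q.-negligible [set w | M w < S i t w / (1 + eps)].
  apply: (negligible_pieces tT) => n a a0; set C := _ `&` _.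
  have FC : F t C.
    apply: sub_sigma_algebraI => //; last exact: filtration_piece.
    rewrite -(measurable_g_measurableTypeE sF).
    apply: (@measurable_lt _ _ (g_sigma_algebraType (F t))) => //.
    exact: measurable_funM.
  have mC := filtration_measurable tT FC.
  apply: nullC => //; have [Q0 QE] := Qfin C mC.
  have : ((a / rho ^+ 3)%:E * Q C <= I (S i T) C)%E.
    apply: (piece_ge tT FC (n := n)).
    - by move=> w [_ []].
    - exact: ltW.
    - by move=> w [_ [_ _ /andP[]]].
  have : (I M C <= (rho * a / (1 + eps))%:E * Q C)%E.
    rewrite -integral_cst//; apply: le_integral => //; last first.
    - move=> w /[!inE] -[/= Mw [_ _ /andP[_ Sa]]]; rewrite lee_fin.
      by apply: (le_trans (ltW Mw)); rewrite ler_pM2r ?invr_gt0// ltW.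
    - exact: ic.
    - exact: integrableS iM.
  rewrite ME// => h /le_trans/(_ h) {h}; rewrite QE -!EFinM lee_fin => h.
  have : a * ((1 + eps - rho ^+ 4) * fine (Q C)) <= 0.
    have : (a / rho ^+ 3 * fine (Q C)) * (rho ^+ 3 * (1 + eps)) <=
           (rho * a / (1 + eps) * fine (Q C)) * (rho ^+ 3 * (1 + eps)).
      by rewrite ler_pM2r// mulr_gt0.
    have r3 : rho ^+ 3 != 0 by rewrite gt_eqF.
    have n0 : 1 + eps != 0 by rewrite gt_eqF.
    have -> : a / rho ^+ 3 * fine (Q C) * (rho ^+ 3 * (1 + eps)) =
      a * (1 + eps) * fine (Q C) by field; rewrite gt_eqF.
    have -> : rho * a / (1 + eps) * fine (Q C) * (rho ^+ 3 * (1 + eps)) =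
      a * rho ^+ 4 * fine (Q C) by field.
    nra.
  by rewrite pmulr_rle0// pmulr_rle0// subr_gt0.
apply: negligibleS (negligibleU up down) => w /= /negP.
by rewrite negb_and -!ltNge => /orP[]; [right|left].
Qed.

End RetiringPrice.

(* The bound in terms of [1 / (1 + sum_j S_0^j)] makes [S_0], and then [S_T],
   integrable. *)
Lemma exists_retiring_measure : exists (Q : probability Omega R) (H : R),
  [/\ equiv_prob Q P,
    (forall n C, G n C -> C `<=` reached rho n T ->
      (Q (C `&` reached rho n.+1 T) <= c%:E * Q C)%E) &
    forall C a, measurable C -> 0 <= a ->
      (forall w, C w -> (1 + \sum_j S j 0 w)^-1 <= a) -> (Q C <= (H * a)%:E * P C)%E].
Proof.
have T00 : 0 <= (0 : R) <= T by rewrite lexx ltW.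
have S00 w : 1 <= 1 + \sum_j S j 0 w.
  by rewrite lerDl sumr_ge0// => j _; apply/ltW/path_pos.
have w01 w : 0 < (1 + \sum_j S j 0 w)^-1 <= 1.
  by rewrite invr_gt0 invf_le1 ?S00 ?(lt_le_trans ltr01 (S00 w)).
have [||||||||||Q [H [_ QP QE Qw]]] := @retiring_measure _ _ _ P (fun n => reached rho n T)
  (fun n => G n) (fun w => (1 + \sum_j S j 0 w)^-1) c.
- rewrite divr_gt0 ?subr_gt0 ?exprn_gt0//= ler_pdivrMr ?exprn_gt0// mul1r.
  by rewrite expr2; nra.
- by move=> n; apply: stopped_sigma_algebra => t tT; exact: filtration_reach.
- by move=> n A [].
- by apply/seteqP; split.
- by move=> n w; exact: reachS.
- by move=> w; exact: (reach_finite (@path_cont w) (@path_pos w) rho1 (ltW T0)).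
- exact: stopped_reached.
- exact: retire_pos.
- apply: (@measurable_comp _ _ _ Omega R R `]0, +oo[%classic (@GRing.inv R) setT
    (fun w => 1 + \sum_j S j 0 w)) => //.
  + by move=> _ [w _ <-] /=; rewrite in_itv/= andbT (lt_le_trans ltr01).
  + apply: open_continuous_measurable_fun => // y; rewrite inE /= in_itv/= andbT => y0.
    by apply: inv_continuous; rewrite gt_eqF.
  + by apply: measurable_funD => //; apply: measurable_sum => j; exact: process_measurable.
- exact: w01.
by exists Q, H.
Qed.

(** [M] is a version of [E_Q[S_T | F_t]], chosen for each coordinate and time separately. On an
    event of [F s] both [M_s] and [M_t] integrate to the integral of [S_T], which is the martingale
    property. *)
Lemma consistent_price_system (eps : R) : 0 < eps -> rho ^+ 4 < 1 + eps ->
  exists M, eps_CPS P T F S eps M.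
Proof.
move=> eps0 rhoe.
have [Q [H [QP Qret Qw]]] := exists_retiring_measure.
have HM (p : 'I_d * R) : exists M, p.2 \in `[0, T] -> [/\ measurable_wrt (F p.2) M,
    Q.-integrable setT (EFin \o M) & forall B, F p.2 B ->
    (\int[Q]_(x in B) (M x)%:E = \int[Q]_(x in B) (S p.1 T x)%:E)%E].
  have [tT|ntT] := boolP (p.2 \in `[0, T]); last by exists (cst 0).
  have tT' : 0 <= p.2 <= T by move: tT; rewrite in_itv.
  have [M [mM iM ME]] := cond_exp (filtration_sigma_algebra tT')
    (@filtration_measurable _ tT') (integrable_end p.1 Qret Qw).
  by exists M.
have [M MP] := choice HM.
have aM : adapted T F (fun i t => M (i, t)) by move=> i t tT; have [] := MP (i, t) tT.
exists (fun i t => M (i, t)); split => //.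
  move=> i t tT; have [mM iM ME] := MP (i, t) tT.
  rewrite in_itv /= in tT.
  have [N [mN QN sub]] := price_bounds (i := i) Qret eps0 rhoe tT mM iM ME.
  by exists N; split => //; apply/QP.
exists Q; split => //; split => // i; split.
  by move=> t tT; have [] := MP (i, t) tT.
move=> s t sT tT st B FB.
have [_ _ MsE] := MP (i, s) sT; have [_ _ MtE] := MP (i, t) tT.
rewrite MsE// MtE//; move: sT tT; rewrite !in_itv /= => /andP[s0 _] /andP[_ tT].
exact: (filtration_le s0 st tT).
Qed.

End Reach.

End StickyProcess.

Unset Implicit Arguments.

Theorem theorem1 (R : realType) (disp : measure_display)
  (Omega : measurableType disp) (P : probability Omega R)
  (T : R) (F : R -> set (set Omega)) (d : nat) (S : 'I_d -> R -> Omega -> R) :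
  0 < T ->
  complete_prob P ->
  usual_filtration P T F ->
  adapted T F S ->
  (forall i w, {within `[0, T], continuous (fun t => S i t w)}) ->
  (forall i t w, t \in `[0, T] -> 0 < S i t w) ->
  sticky P T F S ->
  forall eps : R, 0 < eps ->
    exists M : 'I_d -> R -> Omega -> R, eps_CPS P T F S eps M.
Proof.
move=> T0 Pc uF aS cS S0 stS eps eps0.
(* Thus [rho^4 = 1 + eps / 2], strictly below [1 + eps] as [price_bounds] requires. *)
pose rho : R := Num.sqrt (Num.sqrt (1 + eps / 2)).
have e1 : 1 < 1 + eps / 2 by rewrite ltrDl divr_gt0.
have rho1 : 1 < rho by rewrite /rho -[ltLHS]sqrtr1 ltr_sqrt ?sqrtr_gt0 -?[ltLHS]sqrtr1 ?ltr_sqrt; lra.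
apply: (consistent_price_system T0 uF aS cS S0 rho1 stS eps0).
rewrite (exprM rho 2 2) !sqr_sqrtr ?sqrtr_ge0//; lra.
Qed.
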